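(* Let $n,m,c_1,c_2$ be positive integers with $c_1\ge c_2$ and $2c_2-c_1>2n-2$. Let $G=\mathbf{Z}\stackrel{n}{*}\mathbf{Z}\stackrel{n}{*}\cdots\stackrel{n}{*}\mathbf{Z}$ be the $n$th nilpotent product of $m$ copies of the infinite cyclic group, and let $\mathcal{V}$ be the variety of groups defined by the set of words $\{[\gamma_{c_1+1},\gamma_{c_2+1}]\}$. Then: (i) If $c_2+n<c_1+1$, then $\mathcal{V}M(G)\cong\mathbf{Z}\oplus\cdots\oplus\mathbf{Z}$ ($k$ copies), where $$k=\Big(\sum_{i=c_1+1}^{c_1+n}\chi_i(m)\Big)\Big(\sum_{i=c_2+1}^{c_2+n}\chi_i(m)\Big).$$ (ii) If $c_2+n\ge c_1+1$, then $\mathcal{V}M(G)\cong\mathbf{Z}\oplus\cdots\oplus\mathbf{Z}$ ($k'$ copies), where $$k'=\Big(\sum_{i=c_1+1}^{c_1+n}\chi_i(m)\Big)\Big(\sum_{i=c_2+1}^{c_1}\chi_i(m)\Big)+\chi_2\Big(\sum_{i=c_1+1}^{c_2+n}\chi_i(m)\Big).$$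
   Context: Baer invariant: if $G\cong F/R$ with $F$ free and $\mathcal{V}$ is a variety defined by a set of words $V$, then $\mathcal{V}M(G)=\dfrac{R\cap V(F)}{[RV^*F]}$, where $V(F)$ is the verbal subgroup of $F$ and $[RV^*F]$ is the subgroup generated by all $v(f_1,\ldots,f_{i-1},f_ir,f_{i+1},\ldots,f_k)\,v(f_1,\ldots,f_i,\ldots,f_k)^{-1}$ with $r\in R$, $v\in V$, $f_j\in F$, $1\le i\le k$, $k\in\mathbf{N}$. The word $\gamma_c$ is the left-normed commutator $[x_1,\ldots,x_c]$, and $[\gamma_{c_1+1},\gamma_{c_2+1}]$ is the word $[[x_1,\ldots,x_{c_1+1}],[y_1,\ldots,y_{c_2+1}]]$ in distinct variables. The $n$th nilpotent product of groups $G_1,\ldots,G_m$ is $P/(\gamma_{n+1}(P)\cap[G_i]^* )$, where $P$ is the free product of the $G_i$ and $[G_i]^*$ is the normal closure in $P$ of the subgroups $[G_i,G_j]$, $i\ne j$. For $G_i=\mathbf{Z}$ this is the free nilpotent group $F/\gamma_{n+1}(F)$ of class $n$ and rank $m$, $F$ being free of rank $m$. $\chi_k(d)=\frac1k\sum_{j\mid k}\mu(j)d^{k/j}$, with $\mu$ the Möbius function (the number of basic commutators of weight $k$ on $d$ generators). Empty sums are $0$. *)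

(* Defs.v *)
From HB Require Import structures.
From mathcomp Require Import all_boot all_order all_algebra.
From mathcomp Require Import boolp classical_sets.

Set Implicit Arguments.
Unset Strict Implicit.
Unset Printing Implicit Defensive.

Import GRing.Theory.
Local Open Scope classical_set_scope.
Local Open Scope group_scope.
Local Open Scope quotient_scope.

Notation ghom G H := (UMagmaMorphism.type G H).

Definition isog (G H : groupType) : Prop :=
  exists f : ghom G H, bijective f.

Section Subgroups.
Variable G : groupType.
Implicit Types A B N : set G.

Definition is_subgroup A : Prop :=
  A 1 /\ forall x y, A x -> A y -> A (x / y).

Definition is_normal A : Prop :=
  is_subgroup A /\ forall x y, A x -> A (x ^ y).

Definition gen A : set G := smallest is_subgroup A.

Definition ncl A : set G := smallest is_normal A.

(* The subgroup [A, B], with the convention [~ x, y] = x^-1 y^-1 x y. *)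
Definition comm_sub A B : set G := gen [set [~ a, b] | a in A & b in B].

(* gamma 1 = G and gamma n.+1 = [gamma n, G]; gamma 0 is also G. *)
Definition gamma n : set G := iter n.-1 (comm_sub^~ setT) setT.

Lemma is_subgroupV A x : is_subgroup A -> A x -> A x^-1.
Proof. by move=> [A1 AF] Ax; rewrite -div1g; apply: AF. Qed.

Lemma is_subgroupM A x y : is_subgroup A -> A x -> A y -> A (x * y).
Proof.
by move=> sA Ax Ay; rewrite -[y]invgK; apply: sA.2 => //; apply: is_subgroupV.
Qed.

Lemma is_subgroupI A B :
  is_subgroup A -> is_subgroup B -> is_subgroup (A `&` B).
Proof.
move=> [A1 AF] [B1 BF]; split=> // x y [Ax Bx] [Ay By].
by split; [apply: AF|apply: BF].
Qed.

Lemma is_normalI A B : is_normal A -> is_normal B -> is_normal (A `&` B).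
Proof.
move=> [sA nA] [sB nB]; split; first exact: is_subgroupI.
by move=> x y [Ax Bx]; split; [apply: nA|apply: nB].
Qed.

Lemma gen_subgroup A : is_subgroup (gen A).
Proof.
split=> [B [[B1 _] _] //|x y Ax Ay B [sB AB]].
by apply: sB.2; [apply: Ax|apply: Ay].
Qed.

Lemma gen_normal A : (forall x y, A x -> A (x ^ y)) -> is_normal (gen A).
Proof.
move=> nA; split=> [|x y Ax]; first exact: gen_subgroup.
apply: (Ax [set z | gen A (z ^ y)]); split=> [|z Az /=].
  split=> /= [|u v Au Av]; first by rewrite conj1g; apply: (gen_subgroup A).1.
  by rewrite conjMg conjVg; apply: (gen_subgroup A).2.
by apply: sub_gen_smallest; apply: nA.
Qed.

Lemma ncl_normal A : is_normal (ncl A).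
Proof.
split; first split=> [B [[[B1 _] _] _] //|x y Ax Ay B [nB AB]].
  by apply: nB.1.2; [apply: Ax|apply: Ay].
by move=> x y Ax B [nB AB]; apply: nB.2; apply: Ax.
Qed.

Lemma gamma_normal n : is_normal (gamma n).
Proof.
rewrite /gamma; elim: n.-1 => [|k IHk] /=; first by split.
apply: gen_normal => _ y [a Aa [b _ <-]]; rewrite conjRg.
by exists (a ^ y); [apply: IHk.2|exists (b ^ y)].
Qed.

End Subgroups.

Structure subgroup (G : groupType) := Subgroup {
  subgroup_set :> set G;
  subgroupP : is_subgroup subgroup_set }.

Structure normal_subgroup (G : groupType) := NormalSubgroup {
  normal_set :> set G;
  normalP : is_normal normal_set }.

Section SubgroupType.
Variables (G : groupType) (H : subgroup G).

Record subgroup_type := SubgroupElt {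
  subgroup_elt : G;
  subgroup_eltP : subgroup_elt \in (H : set G) }.

HB.instance Definition _ := [isSub of subgroup_type for subgroup_elt].
HB.instance Definition _ := [Choice of subgroup_type by <:].

Lemma subgroup_closed : group_closed (fun x : G => x \in (H : set G)).
Proof.
have [H1 HF] := subgroupP H.
split=> [|x y]; first exact/mem_set.
by move=> /set_mem Hx /set_mem Hy; apply/mem_set/HF.
Qed.

HB.instance Definition _ := SubChoice_isSubGroup.Build G
  (fun x : G => x \in (H : set G)) subgroup_type subgroup_closed.

Lemma subgroup_elt1 : subgroup_elt 1 = 1.
Proof. exact: (@val1 _ _ subgroup_type). Qed.

Lemma subgroup_eltM : {morph subgroup_elt : x y / x * y}.
Proof. exact: (@valM _ _ subgroup_type). Qed.

HB.instance Definition _ :=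
  isUMagmaMorphism.Build subgroup_type G subgroup_elt
    (subgroup_elt1, subgroup_eltM).

End SubgroupType.

Section Quotient.
Variables (G : groupType) (N : normal_subgroup G).

Definition coset_rel : rel G := fun x y => `[< (N : set G) (x^-1 * y) >].

Lemma coset_rel_equiv : equiv_class_of coset_rel.
Proof.
have [sN nN] := normalP N; split=> [x|x y|y x z].
- by apply/asboolP; rewrite mulVg; apply: sN.1.
- by apply/asboolP/asboolP => /(is_subgroupV sN); rewrite invgM invgK.
- move=> /asboolP xy /asboolP yz; apply/asboolP.
  by rewrite -[z](mulVKg y) mulgA; apply: is_subgroupM.
Qed.

Canonical coset_equiv := EquivRelPack coset_rel_equiv.

Definition quotient := {eq_quot coset_equiv}.

HB.instance Definition _ := Choice.on quotient.
HB.instance Definition _ := EqQuotient.on quotient.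

Definition coset (x : G) : quotient := \pi_quotient x.

Lemma cosetP x y : coset x = coset y <-> (N : set G) (x^-1 * y).
Proof. by split=> [/eqmodP/asboolP|?] //; apply/eqmodP/asboolP. Qed.

Lemma coset_repr u : coset (repr u) = u.
Proof. exact: reprK. Qed.

Lemma repr_coset x : (N : set G) (x^-1 * repr (coset x)).
Proof. by apply/cosetP; rewrite coset_repr. Qed.

Definition quotient_one : quotient := coset 1.
Definition quotient_mul (u v : quotient) : quotient := coset (repr u * repr v).
Definition quotient_inv (u : quotient) : quotient := coset (repr u)^-1.

Lemma quotient_mulE x y : quotient_mul (coset x) (coset y) = coset (x * y).
Proof.
have [sN nN] := normalP N; apply/esym/cosetP.
set x' := repr _; set y' := repr _.
have -> : (x * y)^-1 * (x' * y') = (x^-1 * x') ^ y * (y^-1 * y').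
  by rewrite /conjg invgM !mulgA mulgK.
by apply: is_subgroupM => //; [apply: nN|]; apply: repr_coset.
Qed.

Lemma quotient_invE x : quotient_inv (coset x) = coset x^-1.
Proof.
have [sN nN] := normalP N; apply/cosetP; rewrite invgK.
set x' := repr _.
have -> : x' * x^-1 = (x^-1 * x') ^ x^-1.
  by rewrite /conjg invgK !mulgA mulgV mul1g.
exact/nN/repr_coset.
Qed.

Lemma quotient_mulA : associative quotient_mul.
Proof.
move=> u v w; rewrite -[u]coset_repr -[v]coset_repr -[w]coset_repr.
by rewrite !quotient_mulE mulgA.
Qed.

Lemma quotient_mul1 : left_id quotient_one quotient_mul.
Proof. by move=> u; rewrite -[u]coset_repr quotient_mulE mul1g. Qed.

Lemma quotient_mulr1 : right_id quotient_one quotient_mul.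
Proof. by move=> u; rewrite -[u]coset_repr quotient_mulE mulg1. Qed.

Lemma quotient_mulV : left_inverse quotient_one quotient_inv quotient_mul.
Proof.
by move=> u; rewrite -[u]coset_repr quotient_invE quotient_mulE mulVg.
Qed.

Lemma quotient_mulrV : right_inverse quotient_one quotient_inv quotient_mul.
Proof.
by move=> u; rewrite -[u]coset_repr quotient_invE quotient_mulE mulgV.
Qed.

HB.instance Definition _ := isGroup.Build quotient
  quotient_mulA quotient_mul1 quotient_mulr1 quotient_mulV quotient_mulrV.

End Quotient.

(* For a normal subgroup N of G contained in H, the group H / N. *)
Section SubQuotient.
Variables (G : groupType) (H : subgroup G) (N : normal_subgroup G).

Definition restr_set : set (subgroup_type H) := [set x | (N : set G) (subgroup_elt x)].

Lemma restr_normal : is_normal restr_set.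
Proof.
have [sN nN] := normalP N; rewrite /restr_set.
split; first split=> [|x y] /=.
- exact: sN.1.
- exact: sN.2.
- by move=> x y /=; apply: nN.
Qed.

Definition subquotient : groupType := quotient (NormalSubgroup restr_normal).

End SubQuotient.

(* The free product of a family of groups: words in the disjoint union of the *)
(* factors, modulo the least congruence that identifies the word (g)(h) with  *)
(* (gh) for g, h in a common factor and the word (1) with the empty word.     *)
Section FreeProduct.
Variables (I : choiceType) (G : I -> groupType).

Definition letter : choiceType := {i : I & G i}.

Definition lt_in i (g : G i) : letter := Tagged G g.

Definition lt_inv (l : letter) : letter := lt_in (tagged l)^-1.

Inductive fp_eq : seq letter -> seq letter -> Prop :=
| fp_refl u : fp_eq u u
| fp_sym u v : fp_eq u v -> fp_eq v u
| fp_trans v u w : fp_eq u v -> fp_eq v w -> fp_eq u w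
| fp_cat u u' v v' : fp_eq u u' -> fp_eq v v' -> fp_eq (u ++ v) (u' ++ v')
| fp_one i : fp_eq [:: lt_in (1 : G i)] [::]
| fp_mul i (g h : G i) : fp_eq [:: lt_in g; lt_in h] [:: lt_in (g * h)].

Definition fp_rel : rel (seq letter) := fun u v => `[< fp_eq u v >].

Lemma fp_rel_equiv : equiv_class_of fp_rel.
Proof.
split=> [u|u v|v u w]; first exact/asboolP/fp_refl.
  by apply/asboolP/asboolP; apply: fp_sym.
by move=> /asboolP uv /asboolP vw; apply/asboolP/(fp_trans uv).
Qed.

Canonical fp_equiv := EquivRelPack fp_rel_equiv.

Definition free_product := {eq_quot fp_equiv}.

HB.instance Definition _ := Choice.on free_product.
HB.instance Definition _ := EqQuotient.on free_product.

Definition fp_class (u : seq letter) : free_product := \pi_free_product u.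

Lemma fp_classP u v : fp_class u = fp_class v <-> fp_eq u v.
Proof. by split=> [/eqmodP/asboolP|?] //; apply/eqmodP/asboolP. Qed.

Lemma fp_class_repr x : fp_class (repr x) = x.
Proof. exact: reprK. Qed.

Lemma fp_repr_class u : fp_eq (repr (fp_class u)) u.
Proof. by apply/fp_classP; rewrite fp_class_repr. Qed.

Definition invw (u : seq letter) : seq letter := rev (map lt_inv u).

Lemma fp_eq_invw u v : fp_eq u v -> fp_eq (invw u) (invw v).
Proof.
elim=> {u v} [u|u v _|v u w _ uv _|u u' v v' _ uu' _ vv'|i|i g h].
- exact: fp_refl.
- exact: fp_sym.
- exact: fp_trans.
- by rewrite /invw !map_cat !rev_cat; apply: fp_cat.
- by rewrite /invw /= /lt_inv /= invg1; apply: fp_one.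
- rewrite /invw /rev /= /lt_inv /= invgM; exact: fp_mul.
Qed.

Lemma fp_eq_mulVw u : fp_eq (invw u ++ u) [::].
Proof.
elim: u => [|[i g] u IHu]; first exact: fp_refl.
rewrite /invw /= rev_cons cat_rcons -[lt_inv _ :: _]/([:: _; _] ++ u).
apply: fp_trans IHu; apply: fp_cat (fp_refl _) _.
rewrite -[X in fp_eq _ X]/([::] ++ u); apply: fp_cat (fp_refl _).
apply: (fp_trans (fp_mul _ _)); rewrite mulVg; exact: fp_one.
Qed.

Lemma invwK : involutive invw.
Proof.
move=> u; rewrite /invw map_rev revK -map_comp map_id_in // => -[i g] _.
by rewrite /= /lt_inv /= invgK.
Qed.

Definition fp_unit : free_product := fp_class [::].
Definition fp_prod (x y : free_product) : free_product :=
  fp_class (repr x ++ repr y).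
Definition fp_inv (x : free_product) : free_product := fp_class (invw (repr x)).

Lemma fp_prodE u v : fp_prod (fp_class u) (fp_class v) = fp_class (u ++ v).
Proof. by apply/fp_classP/fp_cat; apply: fp_repr_class. Qed.

Lemma fp_invE u : fp_inv (fp_class u) = fp_class (invw u).
Proof. exact/fp_classP/fp_eq_invw/fp_repr_class. Qed.

Lemma fp_prodA : associative fp_prod.
Proof.
move=> x y z; rewrite -[x]fp_class_repr -[y]fp_class_repr -[z]fp_class_repr.
by rewrite !fp_prodE catA.
Qed.

Lemma fp_prod1 : left_id fp_unit fp_prod.
Proof. by move=> x; rewrite -[x]fp_class_repr fp_prodE. Qed.

Lemma fp_prodr1 : right_id fp_unit fp_prod.
Proof. by move=> x; rewrite -[x]fp_class_repr fp_prodE cats0. Qed.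

Lemma fp_prodV : left_inverse fp_unit fp_inv fp_prod.
Proof.
move=> x; rewrite -[x]fp_class_repr fp_invE fp_prodE.
exact/fp_classP/fp_eq_mulVw.
Qed.

Lemma fp_prodrV : right_inverse fp_unit fp_inv fp_prod.
Proof.
move=> x; rewrite -[x]fp_class_repr fp_invE fp_prodE.
by apply/fp_classP; rewrite -[X in X ++ _]invwK; apply: fp_eq_mulVw.
Qed.

HB.instance Definition _ := isGroup.Build free_product
  fp_prodA fp_prod1 fp_prodr1 fp_prodV fp_prodrV.

Definition fp_in i (g : G i) : free_product := fp_class [:: lt_in g].

(* The normal closure of the subgroups [G_i, G_j], i != j. *)
Definition cartesian : set free_product :=
  ncl (\bigcup_(p in [set p : I * I | p.1 != p.2])
         comm_sub (range (@fp_in p.1)) (range (@fp_in p.2))).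

Definition nilpotent_product (n : nat) : groupType :=
  quotient (NormalSubgroup
    (is_normalI (gamma_normal free_product n.+1) (ncl_normal _ : is_normal cartesian))).

End FreeProduct.

(* Group words: the letter (i, false) is x_i and (i, true) is its inverse. *)
Definition word := seq (nat * bool).

Definition word_inv (w : word) : word := rev [seq (l.1, ~~ l.2) | l <- w].

Definition word_comm (u v : word) : word := word_inv u ++ word_inv v ++ u ++ v.

(* The left-normed commutator [x_s, ..., x_(s+c-1)] of weight c > 0. *)
Definition gamma_word (s c : nat) : word :=
  foldl (fun w i => word_comm w [:: (i, false)]) [:: (s, false)] (iota s.+1 c.-1).

Definition gamma_comm_word (a b : nat) : word :=
  word_comm (gamma_word 0 a) (gamma_word a b).

Section Verbal.
Variables (V : set word).

Definition word_eval (F : groupType) (f : nat -> F) (w : word) : F :=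
  \prod_(l <- w) (if l.2 then (f l.1)^-1 else f l.1).

Definition verbal (F : groupType) : set F :=
  gen [set x | exists2 v, V v & exists f : nat -> F, x = word_eval f v].

Definition upd_mulr (F : groupType) (f : nat -> F) (i : nat) (r : F) : nat -> F :=
  fun j => if j == i then f j * r else f j.

(* The subgroup [R V^* F]. *)
Definition marginal_comm (F : groupType) (R : set F) : set F :=
  gen [set x | exists2 v, V v & exists (f : nat -> F) (i : nat), exists2 r, R r &
         x = word_eval (upd_mulr f i r) v * (word_eval f v)^-1].

Lemma word_evalJ (F : groupType) (f : nat -> F) w y :
  word_eval f w ^ y = word_eval (fun i => f i ^ y) w.
Proof.
rewrite /word_eval conjg_prod; apply: eq_bigr => -[i []] _ //=.
by rewrite conjVg.
Qed.

Lemma word_evalM (F G : groupType) (pi : ghom F G) (f : nat -> F) w :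
  pi (word_eval f w) = word_eval (pi \o f) w.
Proof.
by rewrite /word_eval gmulf_prod; apply: eq_bigr => -[i []] _ //=; rewrite gmulfV.
Qed.

Lemma eq_word_eval (F : groupType) (f g : nat -> F) w :
  f =1 g -> word_eval f w = word_eval g w.
Proof. by move=> fg; apply: eq_bigr => l _; rewrite fg. Qed.

Lemma marginal_comm_normal (F : groupType) (R : set F) :
  is_normal R -> is_normal (marginal_comm R).
Proof.
move=> nR; apply: gen_normal => _ y [v Vv [f [i [r Rr ->]]]].
exists v => //; exists (fun j => f j ^ y), i, (r ^ y); first exact: nR.2.
rewrite conjMg conjVg !word_evalJ; congr (_ * _); apply: eq_word_eval => j.
by rewrite /upd_mulr; case: eqP => // _; rewrite conjMg.
Qed.

End Verbal.

Section Baer.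
Variables (V : set word) (F G : groupType) (pi : ghom F G).

Definition ker : set F := [set x | pi x = 1].

Lemma ker_normal : is_normal ker.
Proof.
rewrite /ker; split; first split=> [|x y /= px py]; rewrite /= ?gmulf1 //.
  by rewrite gmulfF px py divg1.
by move=> x y /= px; rewrite gmulfJ px conj1g.
Qed.

(* (R \cap V(F)) / [R V^* F] with R the kernel of pi : F -> G; this is the    *)
(* Baer invariant V M(G) when pi is a free presentation of G.                 *)
Definition baer_invariant : groupType :=
  subquotient (Subgroup (is_subgroupI ker_normal.1 (gen_subgroup _ : is_subgroup (@verbal V F))))
    (NormalSubgroup (marginal_comm_normal V ker_normal)).

Lemma marginal_comm_sub : marginal_comm V ker `<=` ker `&` @verbal V F.
Proof.
apply: smallest_sub.
  by apply: is_subgroupI; [apply: ker_normal.1|apply: gen_subgroup].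
move=> _ [v Vv [f [i [r /= pr ->]]]]; split.
  rewrite /ker /= gmulfF !word_evalM; apply/eqP; rewrite divg_eq1; apply/eqP.
  apply: eq_word_eval => j /=; rewrite /upd_mulr; case: eqP => // _.
  by rewrite gmulfM pr mulg1.
by apply: (gen_subgroup _).2; apply: sub_gen_smallest; exists v => //; eexists.
Qed.

End Baer.

Definition is_free_on (X : Type) (F : groupType) (b : X -> F) : Prop :=
  forall (H : groupType) (g : X -> H),
    exists f : ghom F H, (forall x, f (b x) = g x) /\
      forall f' : ghom F H, (forall x, f' (b x) = g x) -> f' =1 f.

Definition is_free (F : groupType) : Prop :=
  exists (X : Type) (b : X -> F), is_free_on b.

Definition free_presentation (F G : groupType) (pi : ghom F G) : Prop :=
  is_free F /\ forall y, exists x, pi x = y.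

Local Open Scope ring_scope.

(* The classical Moebius function, for j > 0. *)
Definition moebius (j : nat) : int :=
  if all (fun p => logn p j == 1%N) (primes j) then (-1) ^+ size (primes j)
  else 0.

(* Witt's formula; the argument d is rational because chi 2 is evaluated at a *)
(* sum of values of chi.                                                      *)
Definition chi (k : nat) (d : rat) : rat :=
  k%:R^-1 * \sum_(j <- divisors k) (moebius j)%:~R * d ^+ (k %/ j).

(* The free abelian group of rank k, written multiplicatively. *)
Definition Zpow (k : nat) : groupType := {ffun 'I_k -> Algebra.to_multiplicative int}.

(* Main.v *)
From HB Require Import structures.
Require Import Defs.
From mathcomp Require Import all_boot all_order all_algebra.
From mathcomp Require Import boolp classical_sets functions.
From mathcomp Require Import zify ring.

Import GRing.Theory.

(** Write P for the free group of rank m, with lower central series gamma.  The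
    group G is P / gamma (n + 1), and its Baer invariant can be computed from
    this presentation: an endomorphism of a presentation over G moves the values
    of a word by elements of [R V^* F] only (verbal_fixed), so that lifts between
    two presentations induce mutually inverse maps (baer_isog).  Here the
    invariant is the quotient of
      numer = [gamma (c1 + 1), gamma (c2 + 1)]
    by
      denom = [gamma (c1 + n + 1), gamma (c2 + 1)] [gamma (c1 + 1), gamma (c2 + n + 1)].
    Modulo denom the commutator of gamma (c1 + 1) and gamma (c2 + 1) is
    bilinear with central values (numer_central), so the quotient is abelian and
    generated by commutators of generators of the lower central factors.

    Good generators come from Lazard elimination: the free Lie ring on an
    alphabet X containing h is the direct sum of the multiples of h and of the
    free Lie ring on the brackets [x, h, ..., h] with x <> h.  Eliminating all
    letters of weight at most c2, one after the other, presents the ideal of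
    elements of weight more than c2 as the free Lie ring on a new alphabet.  As a
    product of two new letters weighs at least 2 c2 + 2, the letters of weight w
    generate gamma w / gamma (w + 1) for c2 < w <= 2 c2 + 1 (stage_gen).  Each
    elimination divides 1 - (generating function of the alphabet) by 1 - t^(wt h),
    so a logarithmic derivative and Moebius inversion give their number, chi w m
    (stage_chi).  And since the new alphabet is free, the brackets of distinct
    pairs of letters are linearly independent: some representation of the free
    Lie ring kills the brackets of all pairs but one (stage_rep, letters_exist).

    A commutator of two letters whose weights do not put it into denom is called
    basic.  Basic commutators generate numer modulo denom (numer_gen), and
    counting them gives the two formulas (card_basic).  For their independence,
    denom is generated, modulo a term gamma (D + 1) far enough down, by other
    commutators of pairs of letters (denom_gen); the inequality 2 c2 - c1 > 2 n - 2
    says that only letters of weight at most 2 c2 + 1 intervene.  A product of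
    commutators of distinct pairs of letters of total weight at most D lies in
    gamma (D + 1) only if it is trivial: a representation sigma of the free Lie
    ring on M lets P act on M[[t]], the i-th generator as 1 + sigma_i t, and the
    leading term of the product is the corresponding combination of brackets
    (lead_prodz, letter_comm_independent). *)

Set Implicit Arguments.
Unset Strict Implicit.
Unset Printing Implicit Defensive.

(** * Commutators and congruences modulo a subgroup *)

Section CommutatorIdentities.
Local Open Scope group_scope.
Variable G : groupType.
Implicit Types x y z u v a b h : G.

Lemma commMg x y z : [~ x * y, z] = [~ x, z] ^ y * [~ y, z].
Proof. by rewrite /commg /conjg !gnorm. Qed.

Lemma commgM x y z : [~ x, y * z] = [~ x, z] * [~ x, y] ^ z.
Proof. by rewrite /commg /conjg !gnorm. Qed.

Lemma commVg x y : [~ x^-1, y] = ([~ x, y] ^ x^-1)^-1.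
Proof. by rewrite /commg /conjg !gnorm. Qed.

Lemma conj_commute x y : commute x y -> x ^ y = x.
Proof. by move=> xy; rewrite /conjg xy mulKg. Qed.

Lemma comm_commute x y : commute x y -> [~ x, y] = 1.
Proof. by move=> xy; apply/eqP/commgP. Qed.

Lemma comm_mull u z v : commute z v -> commute z [~ u, v] -> [~ u * z, v] = [~ u, v].
Proof.
move=> zv zuv; rewrite commMg (comm_commute zv) mulg1.
exact/conj_commute/commute_sym.
Qed.

Lemma comm_mulr u z v : commute z u -> commute z [~ u, v] -> [~ u, v * z] = [~ u, v].
Proof.
move=> zv zuv; rewrite commgM (comm_commute (commute_sym zv)) mul1g.
exact/conj_commute/commute_sym.
Qed.

(** What remains of the Hall-Witt identity when all commutators of higher weight
    vanish: expand the conjugate of [~ a, b] by [h] as [~ a ^ h, b ^ h]. *)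
Lemma comm_jacobi a b h :
    commute [~ a, b] [~ a, h] -> commute [~ a, b] [~ b, h] ->
    commute [~ a, h] [~ b, h] -> commute [~ a, [~ b, h]] [~ a, h] ->
    commute [~ a, [~ b, h]] [~ a, b] -> commute [~ [~ a, h], b] [~ b, h] ->
  [~ [~ a, b], h] = [~ a, [~ b, h]] * [~ [~ a, h], b].
Proof.
set a' := [~ a, h]; set b' := [~ b, h] => aba' abb' a'b' ab'a' ab'ab a'bb'.
have conjE x : x ^ h = x * [~ x, h] by rewrite commgEl mulVKg.
apply: (@mulgI _ [~ a, b]); rewrite -conjE conjRg !conjE -/a' -/b'.
rewrite commMg 2!(commgM _ b b') (conj_commute abb') conjMg (conj_commute ab'a').
rewrite (conj_commute aba') (comm_commute a'b') mul1g (conj_commute a'bb').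
by rewrite ab'ab -mulgA.
Qed.

End CommutatorIdentities.

Section Subgroups.
Local Open Scope group_scope.
Local Open Scope classical_set_scope.
Variable G : groupType.
Implicit Types A B K N S T : set G.

Lemma subgroup1 A : is_subgroup A -> A 1.
Proof. by case. Qed.

Lemma is_subgroupRC A x y : is_subgroup A -> A [~ x, y] -> A [~ y, x].
Proof. by move=> sA Axy; rewrite -invgR; apply: is_subgroupV. Qed.

Lemma is_subgroup_setT : is_subgroup (@setT G).
Proof. by []. Qed.

Lemma gen_min A B : is_subgroup B -> A `<=` B -> gen A `<=` B.
Proof. exact: smallest_sub. Qed.

Lemma sub_gen A : A `<=` gen A.
Proof. exact: sub_gen_smallest. Qed.

Lemma genS A B : A `<=` B -> gen A `<=` gen B.
Proof. by move=> AB; apply: gen_min (gen_subgroup _) _ => x /AB /sub_gen. Qed.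

Lemma is_subgroup_commutes K b :
    is_subgroup K -> forall D, is_subgroup D ->
    (forall x y, K x -> D y -> K (x ^ y)) ->
  is_subgroup [set a | D a /\ K [~ a, b]].
Proof.
move=> sK D sD KD; split=> [|x y [Dx Kx] [Dy Ky]] /=.
  by rewrite comm1g; split; apply: subgroup1.
split; first exact: sD.2.
rewrite commMg; apply: is_subgroupM => //; first by apply: KD => //; apply: is_subgroupV.
by rewrite commVg; apply: is_subgroupV => //; apply: KD => //; apply: is_subgroupV.
Qed.

(** Commutation modulo [K] needs only be tested on generators, because the
    elements that commute with a fixed one modulo [K] form a subgroup as soon
    as [K] is normalised by the elements involved. *)
Lemma comm_gen K D S T :
    is_subgroup K -> is_subgroup D -> (forall x y, K x -> D y -> K (x ^ y)) ->
    S `<=` D -> T `<=` D -> (forall s t, S s -> T t -> K [~ s, t]) ->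
  forall a b, gen S a -> gen T b -> K [~ a, b].
Proof.
move=> sK sD KD SD TD KST a b Sa Tb.
have sC c := is_subgroup_commutes c sK sD KD.
have KaT t : T t -> K [~ t, a].
  move=> Tt; apply: is_subgroupRC => //.
  apply: (gen_min (sC t) _ Sa).2 => s Ss; split; [exact: SD|exact: KST].
apply: is_subgroupRC => //.
by apply: (gen_min (sC a) _ Tb).2 => t Tt; split; [apply: TD|apply: KaT].
Qed.

Lemma comm_genN N S T :
    is_normal N -> (forall s t, S s -> T t -> N [~ s, t]) ->
  forall a b, gen S a -> gen T b -> N [~ a, b].
Proof. by case=> sN nN; apply: (comm_gen sN is_subgroup_setT) => // x y /nN. Qed.

Lemma gen_setT a : gen [set: G] a.
Proof. exact: sub_gen. Qed.

End Subgroups.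

Section CosetMorphism.
Local Open Scope group_scope.
Variables (G : groupType) (N : normal_subgroup G).

Lemma cosetM : {morph (@coset G N) : x y / x * y}.
Proof. by move=> x y; apply/esym/quotient_mulE. Qed.

Lemma coset_1 : coset N 1 = 1. Proof. by []. Qed.

HB.instance Definition _ := isUMagmaMorphism.Build G (quotient N) (@coset G N)
  (coset_1, cosetM).

Lemma coset_eq1 x : coset N x = 1 <-> (N : set G) x.
Proof.
split=> [/esym/cosetP|Nx]; first by rewrite invg1 mul1g.
by apply/esym/cosetP; rewrite invg1 mul1g.
Qed.

Lemma coset_commute x y : (N : set G) [~ x, y] -> commute (coset N x) (coset N y).
Proof. by move=> /coset_eq1; rewrite gmulfR => /eqP/commgP. Qed.

End CosetMorphism.

(** * The lower central series *)

Lemma comm_mod (G Q : groupType) (f : ghom G Q) (y y' z z' : G) :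
    commute (f y') (f (z * z')%g) -> commute (f y') (f [~ y, z * z'])%g ->
    commute (f z') (f y) -> commute (f z') (f [~ y, z])%g ->
  f [~ y * y', z * z']%g = f [~ y, z]%g.
Proof.
by rewrite !gmulfR !gmulfM => *; rewrite comm_mull // comm_mulr.
Qed.

Section Gamma.
Local Open Scope group_scope.
Local Open Scope classical_set_scope.
Variable G : groupType.
Implicit Types (i j k : nat).

Lemma gamma_subgroup i : is_subgroup (@gamma G i).
Proof. exact: (gamma_normal G i).1. Qed.

Lemma gammaJ i x y : @gamma G i x -> @gamma G i (x ^ y).
Proof. exact: (gamma_normal G i).2. Qed.

Lemma gammaSR i x y : 0 < i -> @gamma G i x -> @gamma G i.+1 [~ x, y].
Proof. by case: i => // i _ xi; apply: sub_gen; exists x => //; exists y. Qed.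

Lemma gammaS_sub i : @gamma G i.+1 `<=` @gamma G i.
Proof.
case: i => [|i] //; apply: gen_min; first exact: gamma_subgroup.
move=> _ [a ai [b _ <-]]; rewrite commgEl; apply: is_subgroupM.
- exact: gamma_subgroup.
- by apply: is_subgroupV => //; apply: gamma_subgroup.
- exact: gammaJ.
Qed.

Lemma gamma_sub i j : i <= j -> @gamma G j `<=` @gamma G i.
Proof.
move=> /subnK <-; elim: (j - i) => //= k IHk; rewrite addSn.
exact: subset_trans (@gammaS_sub _) IHk.
Qed.

(** Consecutive terms of the series have a central factor, so every subgroup
    between them is normal. *)
Lemma gamma_sub_normal i (K : set G) x y :
    is_subgroup K -> @gamma G i.+1 `<=` K -> K `<=` @gamma G i ->
  K x -> K (x ^ y).
Proof.
move=> sK iK Ki Kx; have -> : x ^ y = x * [~ x, y] by rewrite commgEl mulVKg.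
apply: is_subgroupM => //; apply: (iK); case: i Ki {iK} => [|i] Ki //.
by apply: gammaSR => //; apply: Ki.
Qed.

(** Induction on the weight of the second argument: conjugating [~ y, z] by a
    changes y and z by commutators of higher weight, which are invisible
    modulo the target term. *)
Lemma gammaR i j a b :
  0 < i -> 0 < j -> @gamma G i a -> @gamma G j b -> @gamma G (i + j) [~ a, b].
Proof.
case: j => // j; elim: j => [|j IHj] in i a b * => i0 _ ai.
  by move=> _; rewrite addn1; apply: gammaSR.
move=> bj; have nN := gamma_normal G (i + j.+2).
apply: (@comm_genN _ _ [set a] [set [~ y, z] | y in @gamma G j.+1 & z in setT])
  => //; last exact: sub_gen.
move=> _ _ -> [y yj [z _ <-]] {bj b}.
pose N := NormalSubgroup nN; apply: (is_subgroupRC (gamma_subgroup _)).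
apply/(coset_eq1 N); rewrite gmulfR; apply/eqP; rewrite -conjg_fix; apply/eqP.
rewrite -gmulfJ conjRg.
have -> : y ^ a = y * [~ y, a] by rewrite commgEl mulVKg.
have -> : z ^ a = z * [~ z, a] by rewrite commgEl mulVKg.
have y'i : @gamma G (i + j.+1) [~ y, a].
  by apply: (is_subgroupRC (gamma_subgroup _)); apply: IHj.
have Ny' x : commute (coset N [~ y, a]) (coset N x).
  apply: coset_commute; rewrite /= addnS; apply: gammaSR => //.
  by rewrite addnS.
have z'i : @gamma G i.+1 [~ z, a].
  by apply: (is_subgroupRC (gamma_subgroup _)); apply: gammaSR.
have Nz' x : @gamma G j.+1 x -> commute (coset N [~ z, a]) (coset N x).
  by move=> xj; apply: coset_commute; rewrite /= addnS -addSn; apply: IHj.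
apply: comm_mod; [exact: Ny'|exact: Ny'|exact: Nz'|].
by apply/Nz'/gammaS_sub/gammaSR.
Qed.

Lemma gammaR_sub i j k a b : 0 < i -> 0 < j -> k <= i + j ->
  @gamma G i a -> @gamma G j b -> @gamma G k [~ a, b].
Proof. by move=> i0 j0 kij ai bj; apply: (gamma_sub kij); apply: gammaR. Qed.

End Gamma.

(** * Invariance of the Baer invariant *)

Section BaerInvariance.
Local Open Scope group_scope.
Local Open Scope classical_set_scope.
Variable V : set word.

Lemma eq_hom_subgroup (G H : groupType) (f f' : ghom G H) :
  is_subgroup [set x | f x = f' x].
Proof.
by split=> [|x y fx fy] /=; rewrite ?gmulf1 // !gmulfF fx fy.
Qed.

Lemma preim_subgroup (G H : groupType) (f : ghom G H) (A : set H) :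
  is_subgroup A -> is_subgroup (f @^-1` A).
Proof.
move=> sA; split=> [|x y Ax Ay] /=; first by rewrite gmulf1; apply: sA.1.
by rewrite gmulfF; apply: sA.2.
Qed.

Lemma verbal_hom (G H : groupType) (f : ghom G H) x :
  @verbal V G x -> @verbal V H (f x).
Proof.
move: x; apply: gen_min; first exact/preim_subgroup/gen_subgroup.
move=> _ [v Vv [g ->]] /=; apply: sub_gen; exists v => //.
by exists (f \o g); rewrite word_evalM.
Qed.

Lemma marginal_hom (G H : groupType) (f : ghom G H) (R : set G) (R' : set H) x :
  (forall r, R r -> R' (f r)) -> marginal_comm V R x -> marginal_comm V R' (f x).
Proof.
move=> RR'; move: x; apply: gen_min; first exact/preim_subgroup/gen_subgroup.
move=> _ [v Vv [g [i [r Rr ->]]]] /=; apply: sub_gen; exists v => //.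
exists (f \o g), i, (f r); first exact: RR'.
rewrite gmulfF !word_evalM; congr (_ / _); apply: eq_word_eval => j /=.
by rewrite /upd_mulr; case: eqP => //; rewrite gmulfM.
Qed.

(** An endomorphism over [G] moves each variable of a word by an element of the
    kernel, so it moves the values of the word by elements of [marginal_comm]. *)
Lemma verbal_fixed (F G : groupType) (pi : ghom F G) (f : ghom F F) x :
    (forall y, pi (f y) = pi y) -> @verbal V F x ->
  marginal_comm V (ker pi) (x^-1 * f x).
Proof.
move=> pif; pose N := NormalSubgroup (marginal_comm_normal V (ker_normal pi)).
suff: @verbal V F `<=` [set x | coset N x = (coset N \o f) x].
  by move=> VN /VN /(@cosetP _ N).
apply: gen_min; first exact: (eq_hom_subgroup (coset N) (coset N \o f)).
move=> _ [v Vv [g ->]] /=; rewrite word_evalM.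
pose h k j := if (j < k)%N then f (g j) else g j.
have hN k : coset N (word_eval (h k) v) = coset N (word_eval (h k.+1) v).
  have <- : word_eval (upd_mulr (h k) k ((g k)^-1 * f (g k))) v = word_eval (h k.+1) v.
    apply: eq_word_eval => j; rewrite /upd_mulr /h ltnS.
    by case: (ltngtP j k) => // ->; rewrite mulVKg.
  apply/esym/eqP; rewrite -divg_eq1 -gmulfF; apply/eqP/coset_eq1.
  apply: sub_gen; exists v => //; exists (h k), k, ((g k)^-1 * f (g k)) => //.
  by rewrite /ker /= gmulfM gmulfV pif mulVg.
have h0 k : coset N (word_eval g v) = coset N (word_eval (h k) v).
  by elim: k => [|k ->]; [congr coset; apply: eq_word_eval|apply: hN].
rewrite (h0 (\max_(l <- v) l.1).+1); congr coset; apply: eq_big_seq => l lv.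
rewrite /h ltnS (_ : l.1 <= _ = true) //.
exact: (@leq_bigmax_seq _ _ _ (fun l : nat * bool => l.1)).
Qed.

Section Map.
Variables (F F' G : groupType) (pi : ghom F G) (pi' : ghom F' G) (f : ghom F F').
Hypothesis pi_f : forall x, pi' (f x) = pi x.

Definition baer_sub (F0 : groupType) (pi0 : ghom F0 G) : subgroup F0 :=
  Subgroup (is_subgroupI (ker_normal pi0).1 (gen_subgroup _ : is_subgroup (@verbal V F0))).

Lemma baer_map_subproof (x : subgroup_type (baer_sub pi)) :
  f (subgroup_elt x) \in (baer_sub pi' : set F').
Proof.
case: x => x /= /set_mem[/= px Vx]; apply/mem_set; split; last exact: verbal_hom.
by rewrite /ker /= pi_f.
Qed.

Definition baer_map_sub (x : subgroup_type (baer_sub pi)) :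
  subgroup_type (baer_sub pi') := SubgroupElt (baer_map_subproof x).

Definition baer_map (u : baer_invariant V pi) : baer_invariant V pi' :=
  coset _ (baer_map_sub (repr u)).

Lemma baer_map_coset x : baer_map (coset _ x) = coset _ (baer_map_sub x).
Proof.
apply/esym/cosetP; have /= := @repr_coset _ (NormalSubgroup (restr_normal
  (baer_sub pi) (NormalSubgroup (marginal_comm_normal V (ker_normal pi))))) x.
rewrite /restr_set /= => Nx.
have := @marginal_hom _ _ f (ker pi) (ker pi') _ _ Nx.
rewrite !(gmulfM, gmulfV) => H; apply: H => r; by rewrite /ker /= pi_f.
Qed.

Lemma baer_mapM : {morph baer_map : u v / u * v}.
Proof.
move=> u v; rewrite -[u]coset_repr -[v]coset_repr.
move: (repr u) (repr v) => x y.
rewrite -(cosetM _ x y) !baer_map_coset -cosetM; congr coset.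
by apply: val_inj; rewrite /= gmulfM.
Qed.

Lemma baer_map1 : baer_map 1 = 1.
Proof.
rewrite -(coset_1 _) baer_map_coset -(coset_1 _); congr coset.
by apply: val_inj; rewrite /= gmulf1.
Qed.

HB.instance Definition _ := isUMagmaMorphism.Build
  (baer_invariant V pi) (baer_invariant V pi') baer_map (baer_map1, baer_mapM).

End Map.

Lemma baer_mapK (F F' G : groupType) (pi : ghom F G) (pi' : ghom F' G)
    (f : ghom F F') (f' : ghom F' F)
    (pi_f : forall x, pi' (f x) = pi x) (pi_f' : forall x, pi (f' x) = pi' x) :
  cancel (baer_map pi_f) (baer_map pi_f').
Proof.
move=> u; rewrite -[u]coset_repr; move: (repr u) => x.
rewrite !baer_map_coset; apply/esym/cosetP; rewrite /= /restr_set /=.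
case: x => x /= /set_mem[/= px Vx].
have pi_ff' y : pi (f' (f y)) = pi y by rewrite pi_f' pi_f.
exact: (@verbal_fixed _ _ _ (f' \o f) _ pi_ff').
Qed.

(** The two composites are endomorphisms over [G], and these induce the identity
    on the quotients. *)
Lemma baer_isog (F F' G : groupType) (pi : ghom F G) (pi' : ghom F' G)
    (f : ghom F F') (f' : ghom F' F) :
    (forall x, pi' (f x) = pi x) -> (forall x, pi (f' x) = pi' x) ->
  isog (baer_invariant V pi) (baer_invariant V pi').
Proof.
move=> pi_f pi_f'; exists (baer_map pi_f : ghom _ _).
by exists (baer_map pi_f'); apply: baer_mapK.
Qed.

End BaerInvariance.

Lemma isog_trans (G H K : groupType) : isog G H -> isog H K -> isog G K.
Proof. by move=> [f fb] [g gb]; exists (g \o f); apply: bij_comp. Qed.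

Section GammaJacobi.
Local Open Scope group_scope.
Variable G : groupType.

Lemma comm_jacobi_mod (Q : groupType) (f : ghom G Q) (a b h : G) :
    commute (f [~ a, b]) (f [~ a, h]) -> commute (f [~ a, b]) (f [~ b, h]) ->
    commute (f [~ a, h]) (f [~ b, h]) ->
    commute (f [~ a, [~ b, h]]) (f [~ a, h]) ->
    commute (f [~ a, [~ b, h]]) (f [~ a, b]) ->
    commute (f [~ [~ a, h], b]) (f [~ b, h]) ->
  f [~ [~ a, b], h] = f ([~ a, [~ b, h]] * [~ [~ a, h], b]).
Proof. by rewrite !gmulfR gmulfM !gmulfR; apply: comm_jacobi. Qed.

Lemma gamma_jacobi i j k (a b h : G) :
    0 < i -> 0 < j -> 0 < k ->
    gamma i a -> gamma j b -> gamma k h ->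
  gamma (i + j + k).+1
    (([~ a, [~ b, h]] * [~ [~ a, h], b])^-1 * [~ [~ a, b], h]).
Proof.
move=> i0 j0 k0 ai bj hk; pose N := NormalSubgroup (gamma_normal G (i + j + k).+1).
have ab : gamma (i + j) [~ a, b] by apply: gammaR.
have ah : gamma (i + k) [~ a, h] by apply: gammaR.
have bh : gamma (j + k) [~ b, h] by apply: gammaR.
have abh : gamma (i + (j + k)) [~ a, [~ b, h]] by apply: gammaR => //; lia.
have ahb : gamma (i + k + j) [~ [~ a, h], b] by apply: gammaR => //; lia.
have cN u v x y : gamma u x -> gamma v y -> 0 < u -> 0 < v -> i + j + k < u + v ->
    commute (coset N x) (coset N y).
  by move=> xu yv u0 v0 uv; apply: coset_commute; apply: gammaR_sub xu yv.
apply/(cosetP N)/esym; apply: comm_jacobi_mod;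
  [apply: cN ab ah _ _ _|apply: cN ab bh _ _ _|apply: cN ah bh _ _ _
  |apply: cN abh ah _ _ _|apply: cN abh ab _ _ _|apply: cN ahb bh _ _ _]; lia.
Qed.
End GammaJacobi.

(** * Lazard elimination *)

Section Trees.
Variable I : Type.

Inductive tree := Leaf of I | Node of tree & tree.

HB.instance Definition _ := gen_eqMixin tree.

Fixpoint wt (t : tree) : nat :=
  if t is Node a b then wt a + wt b else 1.

Lemma wt_gt0 t : 0 < wt t.
Proof. by elim: t => //= a a0 b b0; rewrite addn_gt0 a0. Qed.

Fixpoint over_letters (X : seq tree) (t : tree) : Prop :=
  t \in X \/ if t is Node a b then over_letters X a /\ over_letters X b else False.

Definition ad (x h : tree) (j : nat) : tree := iter j (Node^~ h) x.

Lemma wt_ad x h j : wt (ad x h j) = wt x + j * wt h.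
Proof. by elim: j => [|j IHj] /=; rewrite ?addn0 // IHj mulSn addnAC addnA. Qed.

(** Lazard elimination of [h], cut off at weight [N]: the free Lie ring on [X]
    is the sum of the line through [h] and of the free Lie ring on the
    elements [x, h, ..., h]. *)
Definition elimh (N : nat) (h : tree) (X : seq tree) : seq tree :=
  [seq t <- [seq ad x h j | x <- [seq x <- X | x != h], j <- iota 0 N.+1] | wt t <= N].

Lemma mem_elimh N h X x j :
  x \in X -> x != h -> wt (ad x h j) <= N -> ad x h j \in elimh N h X.
Proof.
move=> Xx xh wN; rewrite mem_filter wN; apply: allpairs_f.
  by rewrite mem_filter xh.
rewrite mem_iota add0n ltnS /=; apply: leq_trans wN; rewrite wt_ad.
by have := wt_gt0 h; nia.
Qed.

Lemma elimhP N h X t : t \in elimh N h X ->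
  exists x j, [/\ x \in X, x != h, t = ad x h j & wt t <= N].
Proof.
rewrite mem_filter => /andP[wN /allpairsP[[x j] /= [+ _ tE]]].
by rewrite mem_filter => /andP[xh Xx]; exists x, j; split.
Qed.

Variables (G : groupType) (x : I -> G).
Local Open Scope group_scope.
Local Open Scope classical_set_scope.

Fixpoint tree_val (t : tree) : G :=
  match t with Leaf i => x i | Node a b => [~ tree_val a, tree_val b] end.

Lemma tree_val_gamma t : gamma (wt t) (tree_val t).
Proof. by elim: t => //= a IHa b IHb; apply: gammaR => //; apply: wt_gt0. Qed.

(** Elements of weight [w] of the Lie subring generated by [X] in the graded Lie
    ring of the lower central series. The next term of the series is included in
    place of taking the quotient by it. *)
Definition tree_span (X : seq tree) (w : nat) : set G :=
  gen ([set tree_val t | t in [set t | over_letters X t /\ wt t = w]] `|` gamma w.+1).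

Lemma tree_span_subgroup X w : is_subgroup (tree_span X w).
Proof. exact: gen_subgroup. Qed.

Lemma gamma_tree_span X w : gamma w.+1 `<=` tree_span X w.
Proof. by move=> y wy; apply: sub_gen; right. Qed.

Lemma tree_val_tree_span X t : over_letters X t -> tree_span X (wt t) (tree_val t).
Proof. by move=> Xt; apply: sub_gen; left; exists t. Qed.

Lemma tree_span_gamma X w : tree_span X w `<=` gamma w.
Proof.
apply: gen_min; first exact: gamma_subgroup.
by move=> _ [[t [_ <-] <-]|/gammaS_sub //]; apply: tree_val_gamma.
Qed.

Lemma tree_spanJ X w y z : tree_span X w y -> tree_span X w (y ^ z).
Proof.
move=> yX; apply: (@gamma_sub_normal _ w (tree_span X w)) => //.
- exact: tree_span_subgroup.
- exact: gamma_tree_span.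
- exact: tree_span_gamma.
Qed.

Lemma tree_span_eq X w y z : gamma w.+1 (y^-1 * z) -> tree_span X w y -> tree_span X w z.
Proof.
move=> yz yX; rewrite -[z](mulVKg y); apply: (is_subgroupM (tree_span_subgroup X w)) => //.
exact: gamma_tree_span.
Qed.

Lemma tree_spanR X i j a b : 0 < i -> 0 < j ->
  tree_span X i a -> tree_span X j b -> tree_span X (i + j) [~ a, b].
Proof.
move=> i0 j0; apply: (@comm_gen _ (tree_span X (i + j)) setT) => //.
  exact: tree_span_subgroup.
  by move=> y z yX _; apply: tree_spanJ.
move=> s t [[s' [Xs <-] <-]|si] tj.
  case: tj => [[t' [Xt <-] <-]|tj].
    by apply: (@tree_val_tree_span X (Node s' t')); right.
  by apply: gamma_tree_span; apply: gammaR_sub (tree_val_gamma s') tj; rewrite ?addnS ?wt_gt0.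
have {}tj : gamma j t.
  by case: {si} tj => [[t' [_ <-] <-]|/gammaS_sub //]; apply: tree_val_gamma.
by apply: gamma_tree_span; apply: gammaR_sub si tj.
Qed.

Section Elim.
Variables (N : nat) (h : tree) (X : seq tree).
Let X' := elimh N h X.

(** Bracketing with [h] is a derivation that permutes the new letters up to
    weight [N], so it preserves their span. *)
Lemma over_elimh_ad s : over_letters X' s -> wt s + wt h <= N ->
  tree_span X' (wt s + wt h) [~ tree_val s, tree_val h].
Proof.
have letter t : t \in X' -> wt t + wt h <= N ->
    tree_span X' (wt t + wt h) [~ tree_val t, tree_val h].
  move=> /elimhP[y [j [Xy yh -> _]]] wN.
  by apply: (@tree_val_tree_span X' (Node (ad y h j) h)); left; apply: (@mem_elimh _ _ _ _ j.+1).
elim: s => [i|a IHa b IHb] /= [/letter //|] // [Xa Xb] wN.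
have [[a0 b0] h0] := (wt_gt0 a, wt_gt0 b, wt_gt0 h).
apply: tree_span_eq (gamma_jacobi a0 b0 h0 (tree_val_gamma a) (tree_val_gamma b)
  (tree_val_gamma h)) _.
apply: (is_subgroupM (tree_span_subgroup _ _)).
  rewrite -addnA; apply: tree_spanR => //; first by rewrite addn_gt0 b0.
    exact: tree_val_tree_span.
  by apply: IHb => //; lia.
rewrite addnAC; apply: tree_spanR => //; first by rewrite addn_gt0 a0.
  by apply: IHa => //; lia.
exact: tree_val_tree_span.
Qed.

Lemma tree_span_elimh_ad i a : 0 < i -> i + wt h <= N -> tree_span X' i a ->
  tree_span X' (i + wt h) [~ a, tree_val h].
Proof.
move=> i0 iN aX.
apply: (@comm_gen _ _ setT _ [set tree_val h] (tree_span_subgroup _ _) _ _ _ _ _ _ _ aX)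
  => //; last exact: sub_gen.
  by move=> y z yX _; apply: tree_spanJ.
move=> s _ [[s' [Xs s'i] <-]|si] ->.
  by rewrite -s'i; apply: over_elimh_ad; rewrite ?s'i.
by apply: gamma_tree_span; apply: gammaR_sub si (tree_val_gamma h) => //; apply: wt_gt0.
Qed.

Lemma over_elimh t : over_letters X t -> wt t <= N ->
  t = h \/ tree_span X' (wt t) (tree_val t).
Proof.
have letter y : y \in X -> wt y <= N -> y = h \/ tree_span X' (wt y) (tree_val y).
  move=> Xy wN; have [->|yh] := eqVneq y h; [by left|right].
  have yX' : y \in X' by apply: (@mem_elimh N h X y 0).
  by apply: tree_val_tree_span; case: (y) yX'; left.
elim: t => [i|a IHa b IHb] /= [/letter //|] //.
move=> [Xa Xb] wN; right; have [[a0 b0] h0] := (wt_gt0 a, wt_gt0 b, wt_gt0 h).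
have [ah|aX'] := IHa Xa ltac:(lia); have [bh|bX'] := IHb Xb ltac:(lia).
- by rewrite ah bh commgg; apply: subgroup1 (tree_span_subgroup _ _).
- rewrite ah addnC; apply: (is_subgroupRC (tree_span_subgroup _ _)).
  by apply: tree_span_elimh_ad => //; rewrite ah addnC in wN.
- by rewrite bh; apply: tree_span_elimh_ad => //; rewrite bh in wN.
- exact: tree_spanR.
Qed.

Lemma tree_span_elimh w : wt h < w <= N -> tree_span X w `<=` tree_span X' w.
Proof.
move=> /andP[hw wN]; apply: gen_min; first exact: tree_span_subgroup.
move=> y [[t [Xt tw] <-]|]; last exact: gamma_tree_span.
rewrite -tw; have [th|//] := over_elimh Xt ltac:(lia).
by move: hw; rewrite -tw th ltnn.
Qed.

End Elim.

End Trees.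

(** * Representations of the free Lie ring *)

Section Operators.
Local Open Scope ring_scope.

Definition addfun (U V : zmodType) (f : U -> V) := {morph f : x y / x + y}.

Lemma addfun0 (U V : zmodType) (f : U -> V) : addfun f -> f 0 = 0.
Proof. by move=> fD; apply: (addrI (f 0)); rewrite -fD !addr0. Qed.

Lemma addfunN (U V : zmodType) (f : U -> V) x : addfun f -> f (- x) = - f x.
Proof.
by move=> fD; apply: (addrI (f x)); rewrite -fD !subrr addfun0.
Qed.

Lemma addfunB (U V : zmodType) (f : U -> V) x y : addfun f -> f (x - y) = f x - f y.
Proof. by move=> fD; rewrite fD addfunN. Qed.

Variables (I : Type) (M : zmodType).

Fixpoint tree_op (sigma : I -> M -> M) (t : tree I) (z : M) : M :=
  match t with
  | Leaf i => sigma i z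
  | Node a b => tree_op sigma a (tree_op sigma b z) - tree_op sigma b (tree_op sigma a z)
  end.

End Operators.

Section Hurwitz.
Local Open Scope ring_scope.
Variables (M : zmodType) (xs : nat -> M -> M).
Hypothesis xsD : forall j, addfun (xs j).

(** The [k]-th derivative at 0 of the product of two power series that are given by
    their derivatives at 0, the first one by the operators [xs j], [xs j.+1], ...;
    the recursion is the Leibniz rule. *)
Fixpoint hurwitz (j k : nat) (f : nat -> M) : M :=
  if k is k'.+1 then hurwitz j.+1 k' f + hurwitz j k' (f \o S) else xs j (f 0%N).

Lemma hurwitzD j k f g :
  hurwitz j k (fun l => f l + g l) = hurwitz j k f + hurwitz j k g.
Proof.
elim: k j f g => [|k IHk] j f g /=; first exact: xsD.
by rewrite IHk (IHk _ (f \o S) (g \o S)) addrACA.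
Qed.

Lemma hurwitzN j k f : hurwitz j k (fun l => - f l) = - hurwitz j k f.
Proof.
elim: k j f => [|k IHk] j f /=; first exact: addfunN.
by rewrite IHk (IHk _ (f \o S)) opprD.
Qed.

End Hurwitz.

Section Stages.
Variables (m N c : nat).
Notation tree := (tree 'I_m).

(** The second argument remembers the weights of the letters eliminated so far:
    together with the current alphabet they determine the number of generators. *)
Inductive stage : seq tree -> seq nat -> Prop :=
| stage0 : stage [seq Leaf i | i <- enum 'I_m] [::]
| stageS X E h : stage X E -> h \in X -> wt h <= c ->
    stage (elimh N h X) (wt h :: E).

Local Open Scope ring_scope.

(** The inductive step is coinduction: sequences in [M] carry a representation
    of the alphabet before elimination in which [h] acts as minus the shift and
    the other letters by the Leibniz rule; reading off the first term turns the
    iterated brackets with [h] into the given operators. *)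
Lemma stage_rep X E : stage X E ->
  forall (M : zmodType) (rho : tree -> M -> M), (forall t, addfun (rho t)) ->
  exists (M0 : zmodType) (sigma : 'I_m -> M0 -> M0) (p : M0 -> M),
    [/\ forall i, addfun (sigma i), addfun p, forall y, exists z, p z = y
      & forall t z, t \in X -> p (tree_op sigma t z) = rho t (p z)].
Proof.
elim=> {X E} [|X E h _ IHX hX _] M rho rhoD.
  exists M, (fun i => rho (Leaf i)), id; split=> // [y|t z /mapP[i _ ->]] //.
  by exists y.
pose xs t j := rho (ad t h j).
have xsD t j : addfun (xs t j) by apply: rhoD.
pose rho' (t : tree) (f : nat -> M) : nat -> M :=
  if t == h then fun k => - f k.+1 else fun k => hurwitz (xs t) 0 k f.
have rho'D t : addfun (rho' t).
  move=> f g; apply: funext => k; rewrite /rho'; case: eqP => _ /=.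
    by rewrite opprD.
  exact: hurwitzD.
have [M0 [sigma [p [sD pD p_onto pP]]]] := IHX _ rho' rho'D.
exists M0, sigma, (fun z => p z 0%N); split=> // [x y|y|t z].
- by rewrite pD.
- by have [z zy] := p_onto (fun=> y); exists z; rewrite zy.
have ph y k : p (tree_op sigma h y) k = - p y k.+1 by rewrite pP // /rho' eqxx.
have pad x j k y : x \in X -> x != h ->
    p (tree_op sigma (ad x h j) y) k = hurwitz (xs x) j k (p y).
  move=> Xx xh; elim: j k y => [|j IHj] k y /=.
    by rewrite pP // /rho' (negPf xh).
  rewrite addfunB // (_ : (_ - _) k = p (tree_op sigma (ad x h j) (tree_op sigma h y)) k
    - p (tree_op sigma h (tree_op sigma (ad x h j) y)) k) //.
  rewrite ph !IHj /= (_ : p (tree_op sigma h y) = fun l => - (p y \o S) l).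
    by rewrite hurwitzN // opprK addrC addrK.
  by apply: funext => l; rewrite ph.
by move=> /elimhP[x [j [Xx xh -> _]]]; rewrite pad.
Qed.

Lemma stage_uniq X E : stage X E -> uniq X.
Proof.
elim=> {X E} [|X E h XE uX hX _]; first by rewrite map_inj_uniq ?enum_uniq // => i j [].
apply/filter_uniq/allpairs_uniq; rewrite ?iota_uniq ?filter_uniq //.
(* A letter other than h acts nontrivially in some representation that kills
   h, so it is not a bracket with h. *)
have not_ad x x' k : x \in X -> x != h -> x' \in X -> x <> ad x' h k.+1.
  move=> Xx xh Xx' xE.
  pose rho (t : tree) (z : int) : int := if t == x then z else 0.
  have rhoD t : addfun (rho t).
    by move=> y z; rewrite /rho; case: eqP => // _; rewrite addr0.
  have [M0 [sigma [p [sD pD p_onto pP]]]] := stage_rep XE rhoD.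
  have ph y : p (tree_op sigma h y) = 0 by rewrite pP // /rho eq_sym (negPf xh).
  have pad j y : p y = 0 -> p (tree_op sigma (ad x' h j) y) = 0.
    elim: j y => [|j IHj] y py /=; first by rewrite pP // py addfun0.
    by rewrite addfunB // ph subr0 IHj.
  have [z z1] := p_onto 1.
  have := pP x z Xx; rewrite z1 /rho eqxx xE /= addfunB // ph subr0 pad //.
have adK x i j : (i <= j)%N -> ad x h j = ad (ad x h (j - i)) h i.
  by move=> ij; rewrite /ad -iterD subnKC.
have ad_inj j : injective (fun x => ad x h j).
  by elim: j => [|j IHj] x y //= [] /IHj.
have wlog_inj x x' i j : x \in X -> x != h -> x' \in X -> (i <= j)%N ->
    ad x h i = ad x' h j -> (x, i) = (x', j).
  move=> Xx xh Xx' ij; rewrite (adK _ _ _ ij) => /ad_inj.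
  case: (j - i)%N (subnK ij) => [<- -> //|k _ xE]; last by case: (not_ad x x' k).
move=> u v /allpairsP[[x i] [Xx _ ->]] /allpairsP[[x' j] [Xx' _ ->]] /=.
move: Xx Xx'; rewrite !mem_filter /= => /andP[xh Xx] /andP[x'h Xx'] adE.
have [ij|/ltnW ji] := leqP i j; first exact: wlog_inj.
by apply/esym/wlog_inj.
Qed.

(** Always eliminate a letter of least weight [d]: the letters that this creates
    are heavier, so the number of letters of weight [d] decreases. *)
Lemma stage_exists : exists X E, stage X E /\ forall x, x \in X -> (c < wt x)%N.
Proof.
suff: forall d, (d <= c)%N -> exists X E, stage X E /\ forall x, x \in X -> (d < wt x)%N.
  by apply.
elim=> [_|d IHd dc].
  exists [seq Leaf i | i <- enum 'I_m], [::]; split; first exact: stage0.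
  by move=> x _; apply: wt_gt0.
have [X [E [XE dX]]] := IHd (ltnW dc).
elim: {X}(size _) {-2}X (leqnn (size [seq x <- X | wt x == d.+1])) E XE dX => [|k IHk] X + E XE dX.
  rewrite leqn0 size_eq0 => /eqP X0; exists X, E; split=> // x Xx.
  rewrite ltn_neqAle dX // andbT; apply/eqP => wx.
  by have := mem_filter (fun x => wt x == d.+1) x X; rewrite X0 Xx -wx eqxx.
have [/hasP[h hX /eqP wh] Xk|/hasPn no_h _] := boolP (has (fun x => wt x == d.+1) X).
  have XE' : stage (elimh N h X) (wt h :: E) by apply: stageS => //; rewrite wh.
  apply: (IHk (elimh N h X) _ _ XE').
  - rewrite -ltnS; apply: leq_trans Xk.
    have hF : h \in [seq x <- X | wt x == d.+1] by rewrite mem_filter wh eqxx.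
    rewrite (perm_size (perm_to_rem hF)) /= ltnS.
    apply: uniq_leq_size; first exact/filter_uniq/(stage_uniq XE').
    move=> t; rewrite mem_filter => /andP[/eqP wt_t /elimhP[x [j [Xx xh tE _]]]].
    have uX := stage_uniq XE.
    rewrite (mem_rem_uniq _ (filter_uniq _ uX)) inE mem_filter wt_t eqxx.
    have j0 : j = 0%N.
      by move: wt_t (dX _ Xx); rewrite tE wt_ad wh; case: (j) => //; lia.
    by rewrite tE j0 /= xh Xx.
  - move=> t /elimhP[x [j [Xx _ -> _]]]; rewrite wt_ad.
    by apply: leq_trans (dX _ Xx) (leq_addr _ _).
exists X, E; split=> // x Xx; rewrite ltn_neqAle dX // andbT eq_sym.
exact: no_h.
Qed.

End Stages.

(** * Witt's formula for the number of letters *)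

Section TruncatedPolynomials.
Local Open Scope ring_scope.
Variable N : nat.
Implicit Types p q r : {poly int}.

Definition eq_upto p q := forall k, (k <= N)%N -> p`_k = q`_k.

Lemma eq_upto_eq p q : p = q -> eq_upto p q. Proof. by move=> ->. Qed.

Lemma eq_upto_sym p q : eq_upto p q -> eq_upto q p.
Proof. by move=> pq k kN; rewrite pq. Qed.

Lemma eq_upto_trans q p r : eq_upto p q -> eq_upto q r -> eq_upto p r.
Proof. by move=> pq qr k kN; rewrite pq ?qr. Qed.

Lemma eq_uptoM p p' q q' : eq_upto p p' -> eq_upto q q' -> eq_upto (p * q) (p' * q').
Proof.
move=> pp' qq' k kN; rewrite !coefM; apply: eq_bigr => i _.
by have ik := ltn_ord i; rewrite pp' ?qq' //; lia.
Qed.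

Lemma eq_uptoMl p q r : eq_upto q r -> eq_upto (p * q) (p * r).
Proof. exact: eq_uptoM. Qed.

Lemma eq_uptoD p p' q q' : eq_upto p p' -> eq_upto q q' -> eq_upto (p + q) (p' + q').
Proof. by move=> pp' qq' k kN; rewrite !coefD pp' ?qq'. Qed.

Lemma eq_uptoN p p' : eq_upto p p' -> eq_upto (- p) (- p').
Proof. by move=> pp' k kN; rewrite !coefN pp'. Qed.

Lemma eq_upto_sum (J : Type) (s : seq J) (F F' : J -> {poly int}) :
  (forall i, eq_upto (F i) (F' i)) -> eq_upto (\sum_(i <- s) F i) (\sum_(i <- s) F' i).
Proof.
by move=> FF'; elim/big_ind2: _ => // p p' q q'; apply: eq_uptoD.
Qed.

Lemma eq_uptoXn0 d : (N < d)%N -> eq_upto 'X^d 0.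
Proof. by move=> Nd k kN; rewrite coefXn coef0; case: eqP => // ?; lia. Qed.

Lemma eq_upto_deriv p q : eq_upto p q -> eq_upto ('X * p^`()) ('X * q^`()).
Proof. by move=> pq [|k] kN; rewrite !coefXM //= !coef_deriv pq. Qed.

Definition prodX (D : seq nat) : {poly int} := \prod_(d <- D) (1 - 'X^d).

(** The coefficients of the logarithmic derivative of [prodX D], up to sign. *)
Definition logder (D : seq nat) : {poly int} :=
  \poly_(k < N.+1) (if k == 0%N then 0 else \sum_(d <- D | (d %| k)%N) d%:R).

Lemma logder1 d : (0 < d)%N ->
  eq_upto ((1 - 'X^d) * logder [:: d]) (d%:R * 'X^d).
Proof.
move=> d0 k kN.
have lE j : (j <= N)%N -> (logder [:: d])`_j = d%:R *+ ((0 < j)%N && (d %| j)%N).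
  move=> jN; rewrite coef_poly ltnS jN; case: j jN => // j _.
  by rewrite /= big_cons big_nil; case: ifP; rewrite ?addr0 ?mulr1n ?mulr0n.
rewrite mulrBl mul1r coefB (mulrC 'X^d) mulr_natl coefMn coefXn coefMXn lE //.
case: (ltngtP k d) => [kd|dk|kd].
- rewrite subr0 mul0rn; case: k kd kN => // k kd _.
  by rewrite gtnNdvd.
- rewrite lE ?(leq_trans (leq_subr _ _)) // mul0rn subn_gt0 dk (ltn_trans d0 dk) /=.
  by rewrite dvdn_subl ?(ltnW dk) // subrr.
- by rewrite kd subnn lE // d0 dvdnn subr0.
Qed.

(** The logarithmic derivative turns products into sums. *)
Lemma logderM D : all (leq 1) D ->
  eq_upto (prodX D * logder D) (- ('X * (prodX D)^`())).
Proof.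
elim: D => [_|d D IHD /= /andP[d0 D0]].
  rewrite /prodX big_nil derivC mulr0 oppr0 mul1r => k kN.
  by rewrite coef_poly big_nil if_same if_same coef0.
have -> : logder (d :: D) = logder [:: d] + logder D.
  apply/polyP => k; rewrite coefD !coef_poly; case: ltnP => _; last by rewrite addr0.
  by case: eqP => _; rewrite ?addr0 // !big_cons big_nil; case: ifP => _; rewrite ?addr0 ?add0r.
rewrite /prodX big_cons -/(prodX D) derivM.
have -> : (1 - 'X^d) * prodX D * (logder [:: d] + logder D) =
    prodX D * ((1 - 'X^d) * logder [:: d]) + (1 - 'X^d) * (prodX D * logder D).
  by ring.
apply: eq_upto_trans (eq_uptoD (eq_uptoMl _ (logder1 d0)) (eq_uptoMl _ (IHD D0))) _.
rewrite derivB derivC derivXn sub0r; case: d d0 => // d _.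
by apply: eq_upto_eq; rewrite [_.+1.-1]/= exprS -mulr_natl; ring.
Qed.

(** Compare logarithmic derivatives: that of [1 - m%:R * 'X] is a geometric series
    with ratio [m]. *)
Lemma prodX_count D m : all (leq 1) D -> eq_upto (prodX D) (1 - m%:R * 'X) ->
  forall k, (0 < k <= N)%N -> (\sum_(d <- D | (d %| k)) d = m ^ k)%N.
Proof.
move=> D0 Dm k /andP[k0 kN].
have E : eq_upto ((1 - m%:R * 'X) * logder D) (m%:R * 'X).
  apply: eq_upto_trans (eq_uptoM (eq_upto_sym Dm) (eq_upto_eq erefl)) _.
  apply: eq_upto_trans (logderM D0) _.
  apply: eq_upto_trans (eq_uptoN (eq_upto_deriv Dm)) _.
  by apply: eq_upto_eq; rewrite derivB derivC derivM derivX -polyC_natr derivC; ring.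
have S k' : (k' < N)%N -> (logder D)`_k'.+1 = m%:R * (logder D)`_k' + m%:R *+ (k' == 0%N).
  move=> k'N; have := E k'.+1 k'N.
  rewrite mulrBl mul1r coefB -mulrA -polyC_natr !coefCM coefXM coefX /=.
  by move=> /eqP; rewrite subr_eq => /eqP ->; rewrite eqSS mulr_natr addrC.
have L0 : (logder D)`_0 = 0 by rewrite coef_poly.
have Lk j : (j < N)%N -> (logder D)`_j.+1 = (m ^ j.+1)%:R.
  elim: j => [|j IHj] jN; first by rewrite S // L0 mulr0 add0r expn1.
  by rewrite S // IHj ?(ltnW jN) // addr0 -natrM -expnS.
case: k k0 kN => // k _ kN; have := Lk k kN.
rewrite coef_poly ltnS kN /= -natr_sum => /eqP.
by rewrite Num.Theory.eqr_nat => /eqP.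
Qed.

End TruncatedPolynomials.

Section Moebius.
Local Open Scope ring_scope.

Lemma primes_pM p j : prime p -> ~~ (p %| j)%N -> (0 < j)%N ->
  perm_eq (primes (p * j)) (p :: primes j).
Proof.
move=> pp pj j0; apply: uniq_perm; first exact: primes_uniq.
  by rewrite /= primes_uniq andbT mem_primes pp j0.
by move=> q; rewrite primesM ?(prime_gt0 pp) // (primes_prime pp) !inE.
Qed.

Lemma moebiusM p j : prime p -> ~~ (p %| j)%N -> (0 < j)%N ->
  moebius (p * j) = - moebius j.
Proof.
move=> pp pj j0; rewrite /moebius.
rewrite (perm_all _ (primes_pM pp pj j0)) (perm_size (primes_pM pp pj j0)).
rewrite [all _ (_ :: _)]/= [size (_ :: _)]/=.
have p0 := prime_gt0 pp.
have -> : logn p (p * j) == 1%N.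
  by rewrite lognM // lognE pp p0 dvdnn /= divnn p0 logn1 lognE (negPf pj) !andbF.
have -> : all (fun q => logn q (p * j) == 1%N) (primes j) =
          all (fun q => logn q j == 1%N) (primes j).
  apply: eq_in_all => q; rewrite mem_primes => /and3P[qp _ qj].
  rewrite lognM // [logn q p]lognE qp p0 /= dvdn_prime2 //.
  by case: (eqVneq q p) => [qE|//]; rewrite -qE qj in pj.
by rewrite andTb; case: ifP => _; rewrite ?oppr0 // exprS mulN1r.
Qed.

Lemma moebius_sq p j : prime p -> (p %| j)%N -> (0 < j)%N -> moebius (p * j) = 0.
Proof.
move=> pp pj j0; rewrite /moebius; case: allP => // sf.
have p0 := prime_gt0 pp.
have := sf p; rewrite mem_primes pp muln_gt0 p0 j0 dvdn_mulr // => /(_ isT).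
rewrite lognM // [logn p p]lognE pp p0 dvdnn /= divnn p0 logn1.
by rewrite lognE pp j0 pj.
Qed.

(** Adding or removing the prime p from a squarefree divisor changes the sign. *)
Lemma sum_moebius n : (0 < n)%N ->
  \sum_(j <- divisors n) moebius j = (n == 1%N)%:R.
Proof.
move=> n0; have [->|n1] := eqVneq n 1%N; first by rewrite big_seq1.
have n_gt1 : (1 < n)%N by rewrite ltn_neqAle eq_sym n1.
have pp := pdiv_prime n_gt1; have pn := pdiv_dvd n; set p := pdiv n in pp pn.
have p0 := prime_gt0 pp.
rewrite (bigID (fun j => p %| j)%N) /=.
have np0 : (0 < n %/ p)%N by rewrite divn_gt0 // dvdn_leq.
have -> : \sum_(j <- divisors n | (p %| j)%N) moebius j =
          \sum_(j <- divisors (n %/ p)) moebius (p * j).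
  rewrite -big_filter -(big_map (muln p) xpredT); apply: perm_big.
  apply: uniq_perm; rewrite ?filter_uniq ?divisors_uniq //.
    by rewrite map_inj_uniq ?divisors_uniq // => i j /eqP; rewrite eqn_pmul2l // => /eqP.
  move=> j; rewrite mem_filter -dvdn_divisors //; apply/andP/mapP.
    move=> [/dvdnP[i ->] ijn]; exists i; last by rewrite mulnC.
    rewrite -dvdn_divisors // -(@dvdn_pmul2r p) //.
    by rewrite divnK.
  move=> [i]; rewrite -dvdn_divisors // => i_n ->; split; first exact: dvdn_mulr.
  by rewrite -(divnK pn) mulnC dvdn_pmul2r.
rewrite [X in X + _](bigID (fun j => p %| j)%N) /= big1_seq ?add0r; last first.
  move=> j /andP[pj]; rewrite -dvdn_divisors // => jn; apply: moebius_sq => //.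
  exact: dvdn_gt0 jn.
have -> : \sum_(j <- divisors (n %/ p) | ~~ (p %| j)%N) moebius (p * j) =
          \sum_(j <- divisors n | ~~ (p %| j)%N) - moebius j.
  have -> : \sum_(j <- divisors (n %/ p) | ~~ (p %| j)%N) moebius (p * j) =
          \sum_(j <- divisors (n %/ p) | ~~ (p %| j)%N) - moebius j.
    rewrite big_seq_cond [RHS]big_seq_cond; apply: eq_bigr => j /andP[].
    rewrite -dvdn_divisors // => jn pj; apply: moebiusM => //; exact: dvdn_gt0 jn.
  rewrite -big_filter -[RHS]big_filter; apply: perm_big.
  apply: uniq_perm; rewrite ?filter_uniq ?divisors_uniq //.
  move=> j; rewrite !mem_filter -!dvdn_divisors //; case pj: (p %| j)%N => //=.
  rewrite -[in RHS](divnK pn) Gauss_dvdl // coprime_sym prime_coprime // pj //.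
by rewrite sumrN addNr.
Qed.

(** Moebius inversion. *)
Lemma chi_count (r : nat -> nat) (m N : nat) :
    (forall k, (0 < k <= N)%N -> (\sum_(d <- divisors k) d * r d = m ^ k)%N) ->
  forall k, (0 < k <= N)%N -> chi k m%:R = (r k)%:R.
Proof.
move=> rm k /andP[k0 kN]; rewrite /chi.
have kR : k%:R != 0 :> rat by rewrite Num.Theory.pnatr_eq0 -lt0n.
apply: (mulfI kR); rewrite mulVKf //.
have -> : \sum_(j <- divisors k) (moebius j)%:~R * m%:R ^+ (k %/ j) =
   \sum_(j <- divisors k) \sum_(d <- divisors k | (d %| k %/ j)%N)
     (moebius j)%:~R * (d * r d)%:R :> rat.
  rewrite big_seq [RHS]big_seq; apply: eq_bigr => j; rewrite -dvdn_divisors // => jk.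
  have j0 := dvdn_gt0 k0 jk.
  have kj0 : (0 < k %/ j)%N by rewrite divn_gt0 // dvdn_leq.
  rewrite -natrX -rm; last by rewrite kj0 (leq_trans (leq_div _ _)).
  rewrite natr_sum mulr_sumr -[RHS]big_filter; apply: perm_big.
  apply: uniq_perm; rewrite ?filter_uniq ?divisors_uniq // => d.
  rewrite mem_filter -!dvdn_divisors //; case dkj: (d %| k %/ j)%N => //=.
  by apply/esym; apply: dvdn_trans dkj _; rewrite -{2}(divnK jk) dvdn_mulr.
rewrite (exchange_big_dep xpredT) //=.
have -> : \sum_(d <- divisors k) \sum_(j <- divisors k | (d %| k %/ j)%N)
     (moebius j)%:~R * (d * r d)%:R =
   \sum_(d <- divisors k) (d * r d)%:R * (k == d)%:R :> rat.
  rewrite big_seq [RHS]big_seq; apply: eq_bigr => d; rewrite -dvdn_divisors // => dk.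
  have d0 := dvdn_gt0 k0 dk.
  have kd0 : (0 < k %/ d)%N by rewrite divn_gt0 // dvdn_leq.
  have -> : (k == d) = (k %/ d == 1)%N by rewrite -{1}(divnK dk) -{3}[d]mul1n eqn_pmul2r.
  rewrite -[(k %/ d == 1)%N%:R](@rmorph_nat _ _ (intmul (1 : rat))) -sum_moebius //.
  rewrite rmorph_sum mulr_sumr /= -big_filter.
  rewrite [LHS](eq_bigr (fun j => (d * r d)%:R * (moebius j)%:~R)); last first.
    by move=> j _; rewrite mulrC.
  apply: perm_big; apply: uniq_perm; rewrite ?filter_uniq ?divisors_uniq // => j.
  rewrite mem_filter -!dvdn_divisors //.
  case jk: (j %| k)%N; rewrite ?andbT ?andbF.
    have j0 := dvdn_gt0 k0 jk.
    by rewrite -(@dvdn_pmul2r j) // divnK // -[RHS](@dvdn_pmul2r d) // divnK // mulnC.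
  apply/esym/negbTE; apply: contraFN jk => jkd; apply: dvdn_trans jkd _.
  by rewrite -{2}(divnK dk) dvdn_mulr.
have kk : k \in divisors k by rewrite -dvdn_divisors.
rewrite (bigD1_seq k) ?divisors_uniq //= eqxx mulr1 natrM big1 ?addr0 // => d dk.
by rewrite eq_sym (negPf dk) mulr0.
Qed.

End Moebius.

Section CountLetters.
Local Open Scope ring_scope.
Variables (m N : nat).
Notation tree := (tree 'I_m).

Definition wtgen (X : seq tree) : {poly int} := \sum_(x <- X) 'X^(wt x).

Lemma geometric_upto d : (0 < d)%N ->
  eq_upto N ((1 - 'X^d) * \sum_(j <- iota 0 N.+1) 'X^(j * d)) 1.
Proof.
move=> d0; rewrite -[iota 0 N.+1]/(index_iota 0 N.+1) big_mkord.
under eq_bigr do rewrite mulnC exprM.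
rewrite -(opprB _ 1) mulNr -subrX1 opprB -exprM => k kN.
by rewrite coefB (eq_uptoXn0 (N := N)) // ?coef0 ?subr0 //; nia.
Qed.

(** Eliminating [h] divides [1 - wtgen X] by [1 - 'X^(wt h)], as replacing
    each other letter by its brackets with [h] multiplies it by a geometric
    series. *)
Lemma wtgen_elimh h X : uniq X -> h \in X ->
  eq_upto N ((1 - 'X^(wt h)) * (1 - wtgen (elimh N h X))) (1 - wtgen X).
Proof.
move=> uX hX.
have elimE : eq_upto N (wtgen (elimh N h X))
    (\sum_(x <- X | x != h) 'X^(wt x) * \sum_(j <- iota 0 N.+1) 'X^(j * wt h)).
  rewrite /wtgen big_filter.
  apply: (@eq_upto_trans _ (\sum_(t <- [seq ad x h j | x <- [seq x <- X | x != h],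
     j <- iota 0 N.+1]) 'X^(wt t))).
    rewrite big_mkcond; apply: eq_upto_sum => t; case: leqP => // Nt.
    exact/eq_upto_sym/eq_uptoXn0.
  rewrite big_allpairs_dep big_filter; apply: eq_upto_eq; apply: eq_bigr => x _.
  by rewrite mulr_sumr; apply: eq_bigr => j _; rewrite wt_ad exprD.
have sumE : wtgen X = 'X^(wt h) + \sum_(x <- X | x != h) 'X^(wt x).
  by rewrite /wtgen (bigD1_seq h).
have := eq_uptoMl (1 - 'X^(wt h)) elimE; rewrite -mulr_suml mulrCA => E.
have {}E := eq_upto_trans E (eq_uptoMl _ (geometric_upto (wt_gt0 h))).
rewrite mulrBr mulr1; apply: eq_upto_trans (eq_uptoD (eq_upto_eq erefl) (eq_uptoN E)) _.
by apply: eq_upto_eq; rewrite sumE; ring.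
Qed.

Lemma wtgen_leaves : wtgen [seq Leaf i | i <- enum 'I_m] = m%:R * 'X.
Proof.
rewrite /wtgen big_map big_enum /= sumr_const card_ord mulr_natl.
by [].
Qed.

Lemma stage_count c X E : @stage m N c X E ->
  eq_upto N (prodX E * (1 - wtgen X)) (1 - m%:R * 'X).
Proof.
elim=> {X E} [|X E h XE IHX hX _].
  by rewrite /prodX big_nil mul1r wtgen_leaves.
apply: eq_upto_trans IHX; rewrite /prodX big_cons -mulrA mulrCA.
exact/eq_uptoMl/wtgen_elimh/hX/stage_uniq/XE.
Qed.

Lemma stage_elim_wt c X E : @stage m N c X E -> all (fun d => 0 < d <= c)%N E.
Proof. by elim=> // X' E' h _ IH _ hc /=; rewrite wt_gt0 hc. Qed.

(** When two letters always weigh more than [N] together, products of two or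
    more letters are invisible up to weight [N]. *)
Lemma prodX_heavy c (D : seq nat) : (N <= c.*2.+1)%N -> all (ltn c) D ->
  eq_upto N (prodX D) (1 - \sum_(d <- D) 'X^d).
Proof.
move=> Nc; elim: D => [_|d D IHD /= /andP[cd cD]].
  by rewrite /prodX !big_nil subr0.
rewrite /prodX !big_cons; apply: eq_upto_trans (eq_uptoMl _ (IHD cD)) _.
have small : eq_upto N ('X^d * \sum_(e <- D) 'X^e) 0.
  rewrite mulr_sumr big_seq; elim/big_ind: _ => // [p q p0 q0|e eD].
    by rewrite -[0]addr0; apply: eq_uptoD.
  by rewrite -exprD; apply: eq_uptoXn0; have := allP cD e eD; rewrite /=; lia.
have -> : (1 - 'X^d) * (1 - \sum_(e <- D) 'X^e) =
    1 - ('X^d + \sum_(e <- D) 'X^e) + 'X^d * \sum_(e <- D) 'X^e :> {poly int}.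
  by ring.
apply: eq_upto_trans (eq_uptoD (eq_upto_eq erefl) small) _.
by rewrite addr0.
Qed.

Lemma sum_divisors_count (D : seq nat) k : (0 < k)%N ->
  (\sum_(d <- divisors k) d * count_mem d D = \sum_(d <- D | (d %| k)) d)%N.
Proof.
move=> k0; elim: D => [|x D IHD].
  by rewrite big_nil big1 // => d _; rewrite muln0.
rewrite big_cons -IHD; under eq_bigr do rewrite /= mulnDr.
rewrite big_split /=.
have -> : (\sum_(d <- divisors k) d * (x == d) = if (x %| k) then x else 0)%N.
  case: ifP => [|/negbT] xk; rewrite dvdn_divisors // in xk.
    rewrite (bigD1_seq x) ?divisors_uniq //= eqxx muln1 big1 ?addn0 // => d dx.
    by rewrite eq_sym (negPf dx) muln0.
  rewrite big1_seq // => d /andP[_ dk]; case: eqP => [xd|]; last by rewrite muln0.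
  by rewrite xd dk in xk.
by case: ifP; rewrite ?add0n.
Qed.

(** The weights of the eliminated letters and of the remaining ones together
    factor [1 - m%:R * 'X] into a product of terms [1 - 'X^d], which fixes the
    number of factors of each degree. *)
Lemma stage_chi c X E : N = c.*2.+1 -> @stage m N c X E ->
    (forall x, x \in X -> (c < wt x)%N) ->
  forall w, (c < w <= N)%N -> chi w m%:R = (count (fun x => wt x == w) X)%:R.
Proof.
move=> Nc XE cX w /andP[cw wN]; have E0 := stage_elim_wt XE.
pose D := E ++ map (@wt _) X.
have cD : all (ltn c) (map (@wt _) X) by apply/allP => _ /mapP[x /cX cx ->].
have D0 : all (leq 1) D.
  rewrite all_cat; apply/andP; split; first by apply: sub_all E0 => d /andP[].
  by apply: sub_all cD => d; apply: leq_trans.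
have DE : eq_upto N (prodX D) (1 - m%:R * 'X).
  apply: eq_upto_trans (stage_count XE); rewrite /prodX big_cat /=.
  apply: eq_uptoMl; apply: eq_upto_trans (prodX_heavy _ cD) _; first by rewrite Nc.
  by rewrite big_map.
rewrite (@chi_count (fun k => count_mem k D) _ N) //; last by lia.
  congr _%:R; rewrite count_cat count_map [X in (X + _)%N](_ : _ = 0%N) //.
  apply/count_memPn/negP => /(allP E0) /=; lia.
by move=> k /andP[k0 kN]; rewrite -(prodX_count D0 DE) ?k0 // sum_divisors_count.
Qed.

End CountLetters.

Section IntegerPowers.
Local Open Scope group_scope.
Variable G : groupType.
Implicit Types x y : G.

Definition zexp x (k : int) : G :=
  match k with Posz n => x ^+ n | Negz n => x ^- n.+1 end.

Lemma zexpB x (n p : nat) : zexp x (n%:Z - p%:Z)%R = x ^+ n / x ^+ p.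
Proof.
have [pn|np] := leqP p n; first by rewrite subzn // /= expgnFr.
have -> : (n%:Z - p%:Z)%R = Negz (p - n).-1 by lia.
rewrite /= prednK ?subn_gt0 // expgnFr ?(ltnW np) //.
by rewrite invgM invgK.
Qed.

Lemma int_subnat (k : int) : exists n p : nat, k = (n%:Z - p%:Z)%R.
Proof. by case: k => n; [exists n, 0|exists 0, n.+1]; lia. Qed.

Lemma commuteXV x i j : commute (x ^+ i)^-1 (x ^+ j).
Proof. exact/commute_sym/commuteV/commuteX2. Qed.

Lemma zexpD x (j k : int) : zexp x (j + k)%R = zexp x j * zexp x k.
Proof.
have [n [p ->]] := int_subnat j; have [n' [p' ->]] := int_subnat k.
have -> : (n%:Z - p%:Z + (n'%:Z - p'%:Z))%R = ((n + n')%:Z - (p + p')%:Z)%R by lia.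
rewrite !zexpB !expgnDr invgM -!mulgA; congr (_ * _); rewrite mulgA.
apply/commute_sym/commuteM; first exact: commuteXV.
by apply/commuteV/commute_sym/commuteV/commuteX2.
Qed.

Lemma zexp_commute x y k : commute x y -> commute x (zexp y k).
Proof. by case: k => n xy /=; [|apply: commuteV]; apply: commuteX. Qed.

Lemma zexp_subgroup (A : set G) x k : is_subgroup A -> A x -> A (zexp x k).
Proof.
move=> sA Ax; have AX n : A (x ^+ n).
  elim: n => [|n IHn]; first exact: sA.1.
  by rewrite expgS; apply: is_subgroupM.
by case: k => n; [exact: AX|apply: is_subgroupV (AX _)].
Qed.

End IntegerPowers.

Lemma gmulf_zexp (G H : groupType) (f : ghom G H) x k :
  f (zexp x k) = zexp (f x) k.
Proof. by case: k => n /=; rewrite ?gmulfXVn ?gmulfXn. Qed.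

Section AdditiveAutomorphisms.
Local Open Scope ring_scope.
Variable V : zmodType.

Record autV := AutV {
  aut_fun : V -> V;
  aut_inv : V -> V;
  aut_funK : cancel aut_fun aut_inv;
  aut_invK : cancel aut_inv aut_fun;
  aut_add : addfun aut_fun }.

Lemma autV_eq g h : aut_fun g =1 aut_fun h -> g = h.
Proof.
case: g h => [f f' fK f'K fD] [g g' gK g'K gD] /= /funext fg.
move: fK f'K fD gK g'K gD; rewrite fg => fK f'K fD gK g'K gD.
have f'g' : f' = g' by apply: funext => z; rewrite -{1}[z]g'K fK.
by move: fK f'K; rewrite f'g' => fK f'K; congr AutV; apply: Prop_irrelevance.
Qed.

HB.instance Definition _ := gen_eqMixin autV.
HB.instance Definition _ := gen_choiceMixin autV.

Lemma aut_inv_add g : addfun (aut_inv g).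
Proof.
move=> x y; apply: (can_inj (aut_funK g)).
by rewrite aut_add !aut_invK.
Qed.

Definition aut1 : autV := @AutV id id (fun=> erefl) (fun=> erefl) (fun _ _ => erefl).

Definition autM (g h : autV) : autV.
Proof.
apply: (@AutV (aut_fun g \o aut_fun h) (aut_inv h \o aut_inv g)) => [x|x|x y] /=.
- by rewrite !aut_funK.
- by rewrite !aut_invK.
- by rewrite !aut_add.
Defined.

Definition aut_V (g : autV) : autV :=
  AutV (@aut_invK g) (@aut_funK g) (@aut_inv_add g).

Lemma autMA : associative autM. Proof. by move=> *; apply: autV_eq. Qed.
Lemma aut1M : left_id aut1 autM. Proof. by move=> *; apply: autV_eq. Qed.
Lemma autM1 : right_id aut1 autM. Proof. by move=> *; apply: autV_eq. Qed.
Lemma autVM : left_inverse aut1 aut_V autM.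
Proof. by move=> g; apply: autV_eq => z /=; rewrite aut_funK. Qed.
Lemma autMV : right_inverse aut1 aut_V autM.
Proof. by move=> g; apply: autV_eq => z /=; rewrite aut_invK. Qed.

HB.instance Definition _ := isGroup.Build autV autMA aut1M autM1 autVM autMV.

Lemma aut_funM (g h : autV) z : aut_fun (g * h)%g z = aut_fun g (aut_fun h z).
Proof. by []. Qed.

Lemma aut_fun1 z : aut_fun (1%g : autV) z = z. Proof. by []. Qed.

Lemma aut_funV (g : autV) z : aut_fun g (aut_fun g^-1%g z) = z.
Proof. exact: (@aut_invK g). Qed.

End AdditiveAutomorphisms.

(** * Leading terms of unipotent automorphisms *)

Section LeadingTerms.
Local Open Scope ring_scope.
Variable M : zmodType.
Notation A := (autV (nat -> M)).

Definition vanish (s : nat) (f : nat -> M) := forall k, (k < s)%N -> f k = 0.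

(** The automorphism g is 1 + b t^w + (higher powers of t), where M[[t]] is
    identified with the sequences in M. *)
Definition lead (w : nat) (b : M -> M) (g : A) :=
  forall s f, vanish s f ->
    vanish (s + w) (aut_fun g f - f) /\ (aut_fun g f - f) (s + w)%N = b (f s).

Lemma eq_lead w b c g : b =1 c -> lead w b g -> lead w c g.
Proof. by move=> bc gL s f /gL[? gs]; rewrite -bc. Qed.

Lemma vanish_le s s' f : (s' <= s)%N -> vanish s f -> vanish s' f.
Proof. by move=> ss' f0 k ks'; apply: f0; apply: leq_trans ss'. Qed.

Lemma vanishD s f g : vanish s f -> vanish s g -> vanish s (f + g).
Proof.
by move=> f0 g0 k ks; rewrite [LHS](_ : _ = f k + g k) // f0 // g0 // addr0.
Qed.

Lemma vanishN s f : vanish s f -> vanish s (- f).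
Proof. by move=> f0 k ks; rewrite [LHS](_ : _ = - f k) // f0 // oppr0. Qed.

Definition unipotent (g : A) := forall s f, vanish s f ->
  vanish s (aut_fun g f) /\ aut_fun g f s = f s.

Lemma lead_unipotent w b g : (0 < w)%N -> lead w b g -> unipotent g.
Proof.
move=> w0 gL s f f0; have [gf0 _] := gL s f f0.
have gE : aut_fun g f = (aut_fun g f - f) + f by rewrite subrK.
split; first by rewrite gE; apply: vanishD => //; apply: vanish_le gf0; rewrite leq_addr.
apply/eqP; rewrite -subr_eq0; apply/eqP.
by apply: gf0; rewrite -addn1 leq_add2l.
Qed.

Lemma unipotentM g h : unipotent g -> unipotent h -> unipotent (g * h)%g.
Proof.
move=> gU hU s f /hU[/gU[? gs] hs]; rewrite aut_funM; split=> //.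
by rewrite gs.
Qed.

Lemma unipotent_vanish_inv g s f : unipotent g ->
  vanish s (aut_fun g f) -> vanish s f.
Proof.
move=> gU; elim: s => // s IHs gf0 k; rewrite ltnS leq_eqVlt => /orP[/eqP ->|].
  have f0 : vanish s f by apply/IHs/vanish_le/gf0.
  by have [_ <-] := gU _ _ f0; apply: gf0.
by apply/IHs/vanish_le/gf0.
Qed.

Lemma lead1 w : lead w (fun=> 0) 1%g.
Proof.
move=> s f f0; rewrite aut_fun1 subrr; split=> //.
Qed.

Lemma leadM w b c g h : (0 < w)%N -> lead w b g -> lead w c h ->
  lead w (fun z => b z + c z) (g * h)%g.
Proof.
move=> w0 gL hL s f f0; rewrite aut_funM.
have [hf0 hfs] := lead_unipotent w0 hL f0.
have [gh0 ghs] := gL _ _ hf0; have [h0 hs] := hL _ _ f0.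
have E : aut_fun g (aut_fun h f) - f =
    (aut_fun g (aut_fun h f) - aut_fun h f) + (aut_fun h f - f).
  by rewrite addrA subrK.
split; first by rewrite E; apply: vanishD.
by rewrite E -[LHS]/(_ (s + w)%N + _ (s + w)%N) ghs hs hfs.
Qed.

Lemma leadV w b g : (0 < w)%N -> lead w b g -> lead w (fun z => - b z) g^-1%g.
Proof.
move=> w0 gL s f f0; set y := aut_fun _ f.
have gy : aut_fun g y = f by apply: aut_funV.
have y0 : vanish s y by apply: (unipotent_vanish_inv (lead_unipotent w0 gL)); rewrite gy.
have [gy0 gys] := gL _ _ y0; have [_ ys] := lead_unipotent w0 gL y0.
have E : y - f = - (aut_fun g y - y) by rewrite gy opprB.
split; first by rewrite E; apply: vanishN.
by rewrite E -[LHS]/(- (_ (s + w)%N)) gys -ys gy.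
Qed.

(** From g h = (h g) [~ g, h] and g h - h g = (g - 1) (h - 1) - (h - 1) (g - 1). *)
Lemma leadR w v b c g h : (0 < w)%N -> (0 < v)%N -> lead w b g -> lead v c h ->
  lead (w + v) (fun z => b (c z) - c (b z)) [~ g, h]%g.
Proof.
move=> w0 v0 gL hL s f f0.
set d := aut_fun _ f - f.
have hgd : aut_fun (h * g)%g d =
    (aut_fun g (aut_fun h f - f) - (aut_fun h f - f)) -
    (aut_fun h (aut_fun g f - f) - (aut_fun g f - f)).
  rewrite /d (addfunB _ _ (@aut_add _ (h * g)%g)) -aut_funM -commgC !aut_funM.
  rewrite !(addfunB _ _ (@aut_add _ _)).
  move: (aut_fun g (aut_fun h f)) (aut_fun h (aut_fun g f)) => x y.
  move: (aut_fun g f) (aut_fun h f) => a b'.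
  rewrite -[x - a - _]addrA -opprD -[y - b' - _]addrA -opprD (addrCA a).
  by rewrite opprB subrKA.
have [gf0 gfs] := gL _ _ f0; have [hf0 hfs] := hL _ _ f0.
have [ghf0 ghfs] := gL _ _ hf0; have [hgf0 hgfs] := hL _ _ gf0.
have hgd0 : vanish (s + (w + v)) (aut_fun (h * g)%g d).
  rewrite hgd; apply: vanishD; first by apply: vanish_le ghf0; lia.
  by apply/vanishN; apply: vanish_le hgf0; lia.
have hgds : aut_fun (h * g)%g d (s + (w + v))%N = b (c (f s)) - c (b (f s)).
  rewrite hgd [LHS](_ : _ = (aut_fun g (aut_fun h f - f) - (aut_fun h f - f)) (s + v + w)%N
     - (aut_fun h (aut_fun g f - f) - (aut_fun g f - f)) (s + w + v)%N).
    by rewrite ghfs hgfs hfs gfs.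
  by rewrite -addnA [(v + w)%N]addnC -addnA.
have hgU := unipotentM (lead_unipotent v0 hL) (lead_unipotent w0 gL).
have d0 := unipotent_vanish_inv hgU hgd0.
by split=> //; have [_ <-] := hgU _ _ d0.
Qed.

Lemma leadS w b g : lead w.+1 b g -> lead w (fun=> 0) g.
Proof.
move=> gL s f /gL[gf0 _]; split; first by apply: vanish_le gf0; lia.
by apply: gf0; rewrite addnS.
Qed.

Lemma lead_zexp w b g k : (0 < w)%N -> lead w b g ->
  lead w (fun z => b z *~ k) (zexp g k).
Proof.
move=> w0 gL.
have gX n : lead w (fun z => b z *+ n) (g ^+ n)%g.
  elim: n => [|n IHn]; first exact: lead1.
  rewrite expgS; apply: eq_lead (leadM w0 gL IHn) => z.
  by rewrite mulrS.
case: k => n; first exact: gX.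
exact: leadV (gX _).
Qed.

Lemma lead_unique w b c g : lead w b g -> lead w c g -> b =1 c.
Proof.
move=> gb gc z; pose f k := if k is 0%N then z else 0 : M.
have f0 : vanish 0 f by [].
by have [_ <-] := gb _ _ f0; have [_ ->] := gc _ _ f0.
Qed.

Section OnePlusTimes.
Variables (a : M -> M) (aD : addfun a).

Definition one_plus_t (f : nat -> M) : nat -> M :=
  fun k => f k + (if k is k'.+1 then a (f k') else 0).

Fixpoint one_plus_t_inv (f : nat -> M) (k : nat) : M :=
  f k - (if k is k'.+1 then a (one_plus_t_inv f k') else 0).

Lemma one_plus_tK : cancel one_plus_t one_plus_t_inv.
Proof.
move=> f; apply: funext; elim=> [|k IHk] /=; first by rewrite /one_plus_t addr0 subr0.
by rewrite IHk /one_plus_t addrK.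
Qed.

Lemma one_plus_t_invK : cancel one_plus_t_inv one_plus_t.
Proof. by move=> f; apply: funext; case=> [|k]; rewrite /one_plus_t /= subrK. Qed.

Lemma one_plus_tD : addfun one_plus_t.
Proof.
move=> f g; apply: funext => k; rewrite /one_plus_t.
rewrite [RHS](_ : _ = one_plus_t f k + one_plus_t g k) // /one_plus_t addrACA.
by case: k => [|k]; rewrite ?addr0 // -aD.
Qed.

Definition one_plus_t_aut : A := AutV one_plus_tK one_plus_t_invK one_plus_tD.

Lemma lead_one_plus_t : lead 1 a one_plus_t_aut.
Proof.
move=> s f f0.
have E k : (aut_fun one_plus_t_aut f - f) k = if k is k'.+1 then a (f k') else 0.
  by rewrite [LHS](_ : _ = one_plus_t f k - f k) // /one_plus_t addrC addKr.
split=> [[|k]|]; rewrite ?E ?addn1 //.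
by rewrite ltnS => /f0 ->; apply: addfun0.
Qed.

End OnePlusTimes.

End LeadingTerms.

(** * The free product of infinite cyclic groups *)

Section FreeGroup.
Local Open Scope group_scope.
Local Open Scope classical_set_scope.
Variable m : nat.

Notation Z := (Algebra.to_multiplicative int).
Definition fpZ : groupType := free_product (fun _ : 'I_m => Z).

Definition fpx (i : 'I_m) : fpZ := @fp_in _ (fun=> Z) i (1%R : int).

Section Lift.
Variables (H : groupType) (g : 'I_m -> H).

Definition fp_val (u : seq (letter (fun _ : 'I_m => Z))) : H :=
  \prod_(l <- u) zexp (g (tag l)) (tagged l : int).

Lemma fp_val_eq u v : fp_eq u v -> fp_val u = fp_val v.
Proof.
rewrite /fp_val; elim=> {u v} //.
- by move=> u v w _ -> _ ->.
- by move=> u u' v v' _ uu' _ vv'; rewrite !big_cat uu' vv'.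
- by move=> i; rewrite big_seq1 big_nil.
- by move=> i k l; rewrite !big_cons !big_nil !mulg1 /= -zexpD.
Qed.

Definition fp_lift (x : fpZ) : H := fp_val (repr x).

Lemma fp_lift_class u : fp_lift (fp_class u) = fp_val u.
Proof. exact/fp_val_eq/fp_repr_class. Qed.

Lemma fp_liftM : {morph fp_lift : x y / x * y}.
Proof.
move=> x y; rewrite -[x]fp_class_repr -[y]fp_class_repr.
rewrite (fp_prodE (repr x) (repr y) : fp_class _ * fp_class _ = _).
by rewrite !fp_lift_class /fp_val big_cat.
Qed.

Lemma fp_lift1 : fp_lift 1 = 1.
Proof. by rewrite (fp_lift_class [::]) /fp_val big_nil. Qed.

HB.instance Definition _ := isUMagmaMorphism.Build fpZ H fp_lift (fp_lift1, fp_liftM).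

Lemma fp_liftx i : fp_lift (fpx i) = g i.
Proof. by rewrite fp_lift_class /fp_val big_seq1. Qed.

End Lift.

Lemma fp_inD i (k l : int) :
  @fp_in _ (fun=> Z) i (k + l)%R = @fp_in _ (fun=> Z) i k * @fp_in _ (fun=> Z) i l :> fpZ.
Proof.
rewrite [RHS](fp_prodE [:: lt_in (k : Z)] [:: lt_in (l : Z)]).
exact/esym/fp_classP/fp_mul.
Qed.

Lemma fp_in_zexp i (k : int) : @fp_in _ (fun=> Z) i k = zexp (fpx i) k.
Proof.
have in0 : @fp_in _ (fun=> Z) i 0%R = 1 :> fpZ by apply/fp_classP/(fp_one _ i).
have inX (n : nat) : @fp_in _ (fun=> Z) i n = (fpx i) ^+ n.
  by elim: n => [|n IHn] //; rewrite expgS -IHn -fp_inD -intS.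
case: k => n; first exact: inX.
apply/esym/mulg1_eq; rewrite -inX -fp_inD.
by rewrite (_ : (_ + _)%R = 0%R) //; lia.
Qed.

Lemma fp_ind (K : set fpZ) : is_subgroup K -> (forall i, K (fpx i)) -> forall x, K x.
Proof.
move=> sK Kx x; rewrite -[x]fp_class_repr; elim: (repr x) => [|[i k] u IHu].
  exact: sK.1.
rewrite -cat1s -(fp_prodE [:: existT _ i k] u).
have Kik : K (@fp_in _ (fun=> Z) i k) by rewrite fp_in_zexp; apply: zexp_subgroup.
exact: (is_subgroupM sK Kik IHu).
Qed.

Lemma fp_gen : gen (range fpx) = setT.
Proof.
rewrite -subTset => x _; apply: fp_ind; first exact: gen_subgroup.
by move=> i; apply: sub_gen; exists i.
Qed.

Lemma fp_hom_eq (H : groupType) (f f' : ghom fpZ H) :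
  (forall i, f (fpx i) = f' (fpx i)) -> f =1 f'.
Proof. by move=> ff'; apply: fp_ind (eq_hom_subgroup f f') ff'. Qed.

(** * Generation of the lower central factors *)

Lemma gamma_sub_tree_span0 w : 0 < w ->
  gamma w `<=` tree_span fpx [seq Leaf i | i <- enum 'I_m] w.
Proof.
set X := map _ _; case: w => // w _; elim: w => [|w IHw].
  move=> x _; apply: fp_ind; first exact: tree_span_subgroup.
  move=> i; apply: (@tree_val_tree_span _ _ _ X (Leaf i)); left.
  by rewrite map_f ?mem_enum.
apply: gen_min; first exact: tree_span_subgroup.
move=> _ [a aw [b _ <-]]; rewrite -addn1; apply: tree_spanR => //; first exact: IHw.
apply: fp_ind b; first exact: tree_span_subgroup.
by move=> i; apply: (@tree_val_tree_span _ _ _ X (Leaf i)); left; rewrite map_f ?mem_enum.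
Qed.

Lemma stage_tree_span N c X E : @stage m N c X E ->
  forall w, c < w <= N -> gamma w `<=` tree_span fpx X w.
Proof.
elim=> {X E} [w /andP[cw _]|X E h _ IHX hX hc w /andP[cw wN]].
  by apply: gamma_sub_tree_span0; apply: leq_trans cw.
apply: subset_trans (IHX w _) _; first by rewrite cw.
by apply: tree_span_elimh; rewrite wN (leq_ltn_trans hc).
Qed.

(** Letters weigh more than [c], so a bracket over them weighs at least 2c + 2. *)
Lemma stage_gen c X E : @stage m c.*2.+1 c X E -> (forall x, x \in X -> c < wt x) ->
  forall w, c < w <= c.*2.+1 ->
  gamma w `<=` gen ([set tree_val fpx t | t in [set t | t \in X /\ wt t = w]] `|` gamma w.+1).
Proof.
move=> XE cX w wc; apply: subset_trans (stage_tree_span XE wc) _.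
have over_gt t : over_letters X t -> c < wt t.
  by elim: t => [i|a IHa b IHb] /= [/cX//|] // [/IHa + /IHb]; lia.
apply: gen_min; first exact: gen_subgroup.
move=> y [[t [Xt tw] <-]|yw]; apply: sub_gen; [left|by right].
exists t => //; split=> //; case: t Xt tw => [i|a b] /= [] // [/over_gt a_c /over_gt b_c] ab.
by exfalso; move: wc; rewrite -ab; lia.
Qed.

(** * The Magnus representation *)

Section Magnus.
Variables (M : zmodType) (sigma : 'I_m -> M -> M).
Hypothesis sigmaD : forall i, addfun (sigma i).

Definition magnus : ghom fpZ (autV (nat -> M)) :=
  fp_lift (fun i => one_plus_t_aut (sigmaD i)).

Lemma magnusx i : magnus (fpx i) = one_plus_t_aut (sigmaD i).
Proof. exact: fp_liftx. Qed.

Lemma lead_tree_val t : lead (wt t) (tree_op sigma t) (magnus (tree_val fpx t)).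
Proof.
elim: t => [i|a IHa b IHb] /=; first by rewrite magnusx; apply: lead_one_plus_t.
rewrite gmulfR; apply: eq_lead (leadR (wt_gt0 a) (wt_gt0 b) IHa IHb).
by [].
Qed.

(** Leading terms of commutators are brackets of leading terms, so the exponent of
    t grows with the position in the lower central series. *)
Lemma gamma_lead w x : 0 < w -> gamma w x ->
  exists2 b, addfun b & lead w b (magnus x).
Proof.
have sub v : 0 < v ->
    is_subgroup [set x | exists2 b, addfun b & lead v b (magnus x)].
  move=> v0; split=> [|y z [b bD yb] [c cD zc]] /=.
    by exists (fun=> 0%R); [move=> u u'; rewrite addr0|rewrite gmulf1; apply: lead1].
  exists (fun u => b u + - c u)%R.
    by move=> u u'; rewrite bD cD opprD addrACA.
  by rewrite gmulfF; apply: leadM => //; apply: leadV.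
have gen1 : gamma 1 `<=` [set x | exists2 b, addfun b & lead 1 b (magnus x)].
  move=> y _; apply: fp_ind; first exact: sub.
  by move=> i; exists (sigma i) => //; rewrite magnusx; apply: lead_one_plus_t.
case: w => // w _; elim: w x => [|w IHw] x; first exact: gen1.
move: x; apply: gen_min; first exact: sub.
move=> _ [a /IHw[b bD ab] [y y1 <-]]; have [c cD yc] := gen1 y I.
exists (fun u => b (c u) - c (b u))%R.
  by move=> u u'; rewrite !(bD, cD) opprD addrACA.
by rewrite gmulfR -addn1; apply: leadR.
Qed.

Lemma gammaS_lead w x : 0 < w -> gamma w.+1 x -> lead w (fun=> 0%R) (magnus x).
Proof. by move=> w0 /gamma_lead[] // b _ /leadS. Qed.

End Magnus.

End FreeGroup.

(** * Commuting families *)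

Section CommutingFamily.
Local Open Scope group_scope.
Local Open Scope classical_set_scope.
Variables (Q : groupType) (J : eqType) (e : J -> Q).
Implicit Types (s : seq J) (a b : J -> int).

Definition prodz s a : Q := \prod_(u <- s) zexp (e u) (a u).

Lemma prodz0 s : prodz s (fun=> 0%R) = 1.
Proof. by rewrite /prodz big1. Qed.

Lemma prodz_cat s t a : prodz (s ++ t) a = prodz s a * prodz t a.
Proof. by rewrite /prodz big_cat. Qed.

Lemma eq_prodz s a b : {in s, a =1 b} -> prodz s a = prodz s b.
Proof. by move=> ab; apply: eq_big_seq => u /ab ->. Qed.

Hypothesis eC : forall u v, commute (e u) (e v).

Lemma prodz_commute u k s a : commute (zexp (e u) k) (prodz s a).
Proof.
rewrite /prodz; elim: s => [|v s IHs]; first by rewrite big_nil; apply: commute1.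
rewrite big_cons; apply: commuteM => //; apply: zexp_commute.
exact/commute_sym/zexp_commute.
Qed.

Lemma prodzD s a b : prodz s (fun u => a u + b u)%R = prodz s a * prodz s b.
Proof.
elim: s => [|u s IHs]; first by rewrite /prodz !big_nil mulg1.
rewrite /prodz !big_cons -!/(prodz s _) IHs zexpD -!mulgA; congr (_ * _).
by rewrite !mulgA; congr (_ * _); apply: prodz_commute.
Qed.

Lemma prodzN s a : prodz s (fun u => - a u)%R = (prodz s a)^-1.
Proof.
apply/esym/mulg1_eq; rewrite -prodzD -(prodz0 s).
by apply: eq_prodz => u _; rewrite subrr.
Qed.

Lemma prodz_delta s u : uniq s -> u \in s ->
  prodz s (fun v => (v == u)%:R)%R = e u.
Proof.
elim: s => // v s IHs /= /andP[vs us]; rewrite in_cons /prodz big_cons -/(prodz s _).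
have [uv _|_ /= /(IHs us) ->] := eqVneq u v; last by rewrite mul1g.
rewrite -[RHS]mulg1 -(prodz0 s); congr (_ * _); first by rewrite uv.
apply: eq_prodz => w ws.
by case: eqP => // wu; move: vs; rewrite -uv -wu ws.
Qed.

Lemma gen_prodz s x : uniq s -> gen (e @` [set` s]) x -> exists a, x = prodz s a.
Proof.
move=> us; move: x; apply: gen_min.
  split; first by exists (fun=> 0%R); rewrite prodz0.
  move=> x y [a ->] [b ->]; exists (fun u => a u - b u)%R.
  by rewrite prodzD prodzN.
by move=> _ [u su <-]; exists (fun v => (v == u)%:R)%R; rewrite prodz_delta.
Qed.

End CommutingFamily.

Lemma gmulf_prodz (G H : groupType) (f : ghom G H) (J : eqType) (e : J -> G) s a :
  f (prodz e s a) = prodz (f \o e) s a.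
Proof.
by rewrite /prodz gmulf_prod; apply: eq_bigr => u _; rewrite gmulf_zexp.
Qed.

Section FreeAbelian.
Local Open Scope group_scope.
Local Open Scope classical_set_scope.

Lemma isog_Zpow (Q : groupType) (J : eqType) (s : seq J) (e : J -> Q) :
    (forall x y : Q, commute x y) -> uniq s ->
    gen (e @` [set` s]) = setT ->
    (forall a, prodz e s a = 1 -> {in s, a =1 fun=> 0%R}) ->
  isog Q (Zpow (size s)).
Proof.
move=> QC us egen eI.
have eC u v : commute (e u) (e v) by [].
pose ext (a : Zpow (size s)) (u : J) : int :=
  if insub (index u s) is Some i then a i else 0%R.
have extE a (i : 'I_(size s)) : ext a (tnth (in_tuple s) i) = a i.
  by rewrite /ext (tnth_nth (tnth (in_tuple s) i)) /= index_uniq // valK.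
have extD a b u : ext (a * b) u = (ext a u + ext b u)%R.
  by rewrite /ext; case: insubP => [i _ _|_]; rewrite ?addr0 // ffunE.
pose phi (a : Zpow (size s)) : Q := prodz e s (ext a).
have phiM : {morph phi : a b / a * b}.
  by move=> a b; rewrite /phi -prodzD //; apply: eq_prodz => u _; apply: extD.
have phi_onto x : exists a, phi a = x.
  have [|b ->] := @gen_prodz _ _ e eC s x us; first by rewrite egen.
  exists [ffun i => b (tnth (in_tuple s) i)]; apply: eq_prodz => u us'.
  rewrite /ext; case: insubP => [i _ iE|]; last by rewrite index_mem us'.
  by rewrite ffunE (tnth_nth u) /= iE nth_index.
have phi1 : phi 1 = 1 by apply: (mulIg (phi 1)); rewrite -phiM !mul1g.
have phiV a : phi a^-1 = (phi a)^-1 by apply/esym/mulg1_eq; rewrite -phiM mulgV.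
have phi_inj : injective phi.
  move=> a b ab; have : phi (a / b) = 1 by rewrite phiM phiV ab mulgV.
  move=> /eI H; apply/eqP; rewrite -divg_eq1; apply/eqP/ffunP => i.
  by rewrite -extE H ?mem_tnth // ffunE.
pose psi x : Zpow (size s) := projT1 (cid (phi_onto x)).
have psiK : cancel psi phi by move=> x; apply: (projT2 (cid (phi_onto x))).
have phiK : cancel phi psi by move=> a; apply: phi_inj; rewrite psiK.
have psiM : {morph psi : x y / x * y}.
  by move=> x y; apply: phi_inj; rewrite phiM !psiK.
have psi1 : psi 1 = 1 by apply: phi_inj; rewrite psiK phi1.
pose psi_mixin := isUMagmaMorphism.Build _ _ psi (psi1, psiM).
pose psi_hom : ghom Q (Zpow (size s)) := HB.pack psi psi_mixin.
by exists psi_hom, phi.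
Qed.

End FreeAbelian.

(** * The letters of weight c + 1, ..., 2c + 1 *)

Section Letters.
Local Open Scope classical_set_scope.

Lemma stage_wt_le m N c X E x : 0 < N -> @stage m N c X E -> x \in X -> wt x <= N.
Proof.
move=> N0; case=> {X E} [/mapP[i _ ->] //|X E h _ _ _].
by rewrite mem_filter => /andP[].
Qed.

(** What the elimination is used for. The last field separates the bracket of one
    pair of letters from the brackets of all others. *)
Record letters (m c r : nat) (y : 'I_r -> tree 'I_m) : Prop := Letters {
  letters_wt : forall i, c < wt (y i) <= c.*2.+1;
  letters_sorted : forall i j : 'I_r, i <= j -> wt (y i) <= wt (y j);
  letters_gen : forall w, c < w <= c.*2.+1 -> gamma w `<=`
    gen ([set tree_val (@fpx m) (y i) | i in [set i | wt (y i) = w]] `|` gamma w.+1);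
  letters_chi : forall w, c < w <= c.*2.+1 ->
    (chi w m%:R = #|[set i | wt (y i) == w]%SET|%:R)%R;
  letters_rep : forall i j : 'I_r, j < i ->
    exists (M : zmodType) (sigma : 'I_m -> M -> M) (phi : M -> int) (z : M),
    [/\ forall k, addfun (sigma k), addfun phi &
      forall k l : 'I_r, l < k -> phi (tree_op sigma (Node (y k) (y l)) z) =
        ((k, l) == (i, j))%:R%R] }.

Lemma letters_exist m c : exists r (y : 'I_r -> tree 'I_m), letters c y.
Proof.
have [X [E [XE cX]]] := @stage_exists m c.*2.+1 c.
pose le_wt := relpre (@wt 'I_m) leq.
pose Y := sort le_wt X; pose y := tnth (in_tuple Y).
have YX : Y =i X by apply: mem_sort.
have uY : uniq Y by rewrite sort_uniq; apply: stage_uniq XE.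
have Yy t : t \in Y -> exists i, y i = t.
  by move=> tY; have /tnthP[i ->] : t \in in_tuple Y by []; exists i.
have yX i : y i \in X by rewrite -YX; apply: mem_tnth.
have y_inj : injective y by apply/tuple_uniqP.
exists (size Y), y; split.
- by move=> i; rewrite cX //= (stage_wt_le _ XE).
- move=> i j ij.
  have : sorted le_wt Y by apply: sort_sorted => ? ?; apply: leq_total.
  have le_refl : reflexive le_wt by move=> ?; apply: leqnn.
  have le_tr : transitive le_wt by move=> ? ? ?; apply: leq_trans.
  have [t0 yE] : exists t0, forall k, y k = nth t0 Y k.
    by exists (y i) => k; apply: tnth_nth.
  move=> /(sorted_leq_nth le_tr le_refl t0) H.
  by have := H i j; rewrite !inE !ltn_ord ij !yE => /(_ isT isT isT).
- move=> w wc; apply: subset_trans (stage_gen XE cX wc) _; apply: genS => x.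
  move=> [[t [Xt tw] <-]|xw]; [left|by right].
  by have [|i yi] := Yy t; [rewrite YX|exists i; rewrite /= yi].
- move=> w wc; rewrite (stage_chi erefl XE cX wc); congr _%:R%R.
  have -> : count (fun x => wt x == w) X = count (fun x => wt x == w) Y.
    by rewrite (permP (permEl (perm_sort le_wt X))).
  rewrite -[Y in LHS](map_tnth_enum (in_tuple Y)) count_map cardsE cardE -size_filter.
  by rewrite {2}/enum_mem -enumT.
(* The Heisenberg Lie algebra acting on three coordinates: [y j] moves the first
   to the second, [y i] the second to the third, and the other letters act as 0. *)
- move=> i j ji; pose R3 : zmodType := (int * int * int)%type.
  pose rho (t : tree 'I_m) (v : R3) : R3 :=
    if t == y j then (0, v.1.1, 0)%R else if t == y i then (0, 0, v.1.2)%R else 0%R.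
  have rhoD t : addfun (rho t).
    move=> u v; rewrite /rho; case: ifP => _; last case: ifP => _;
      by apply/eqP; rewrite /= !xpair_eqE /= ?addr0 ?eqxx.
  have [M [sigma [p [sD pD p_onto pP]]]] := stage_rep XE rhoD.
  have [z z1] := p_onto (1, 0, 0)%R.
  exists M, sigma, (fun v => (p v).2), z; split=> // [u v|k l lk]; first by rewrite pD.
  rewrite /= addfunB // !pP // z1 /rho !(inj_eq y_inj) xpair_eqE.
  have [kj|kj] := eqVneq k j; have [lj|lj] := eqVneq l j;
    have [ki|ki] := eqVneq k i; have [li|li] := eqVneq l i => //=; exfalso; subst; lia.
Qed.

End Letters.

(** * Commutators of letters *)

Section LetterCommutators.
Local Open Scope group_scope.
Local Open Scope classical_set_scope.
Variables (m c r : nat) (y : 'I_r -> tree 'I_m).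
Hypothesis yL : letters c y.
Notation P := (fpZ m).
Notation pair := ('I_r * 'I_r)%type.

Definition letter_val (i : 'I_r) : P := tree_val (@fpx m) (y i).
Definition letter_comm (u : pair) : P := [~ letter_val u.1, letter_val u.2].
Definition comm_wt (u : pair) : nat := wt (y u.1) + wt (y u.2).

Lemma letter_val_gamma i : gamma (wt (y i)) (letter_val i).
Proof. exact: tree_val_gamma. Qed.

Lemma letter_comm_gamma u : gamma (comm_wt u) (letter_comm u).
Proof. by apply: gammaR (letter_val_gamma _) (letter_val_gamma _); apply: wt_gt0. Qed.

Lemma lead_prodz (M : zmodType) (sigma : 'I_m -> M -> M)
    (sigmaD : forall k, addfun (sigma k)) (v : nat) (s : seq pair) (a : pair -> int) :
    0 < v -> (forall u, u \in s -> comm_wt u < v -> a u = 0%R) ->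
  lead v (fun z => \sum_(u <- s | comm_wt u == v) tree_op sigma (Node (y u.1) (y u.2)) z *~ a u)%R
    (magnus sigmaD (prodz letter_comm s a)).
Proof.
move=> v0; elim: s => [|u s IHs] a0.
  rewrite /prodz big_nil gmulf1; apply: eq_lead (lead1 _) => z.
  by rewrite big_nil.
have {}IHs := IHs (fun w ws => a0 w (mem_behead (s := u :: s) ws)).
rewrite /prodz big_cons -/(prodz letter_comm s a) gmulfM gmulf_zexp.
pose b z := (if comm_wt u == v then tree_op sigma (Node (y u.1) (y u.2)) z *~ a u else 0)%R.
have uL : lead v b (zexp (magnus sigmaD (letter_comm u)) (a u)).
  rewrite /b; case: (ltngtP (comm_wt u) v) => [uv|vu|uv].
  - by rewrite a0 ?mem_head //; apply: lead1.
  - apply: eq_lead (lead_zexp (a u) v0 _) => [z|]; last first.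
      by apply: gammaS_lead => //; apply: gamma_sub (letter_comm_gamma u).
    by rewrite mul0rz.
  - apply: lead_zexp => //; rewrite -uv; exact: (lead_tree_val sigmaD (Node (y u.1) (y u.2))).
apply: eq_lead (leadM v0 uL IHs) => z.
by rewrite big_cons /b; case: ifP => // _; rewrite add0r.
Qed.

(** By induction on the weight: the leading term of the product is a linear
    relation between brackets of letters, and a representation that detects one
    pair shows that its coefficient vanishes. *)
Lemma letter_comm_independent D (s : seq pair) (a : pair -> int) :
    uniq s -> (forall u, u \in s -> (u.2 < u.1)%N && (comm_wt u <= D)) ->
    gamma D.+1 (prodz letter_comm s a) ->
  {in s, a =1 fun=> 0%R}.
Proof.
move=> us sD sa; suff H v u : u \in s -> comm_wt u < v -> a u = 0%R.
  by move=> u su; apply: (H (comm_wt u).+1).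
elim: v u => // v IHv [i j] su; rewrite ltnS leq_eqVlt => /orP[/eqP uv|]; last exact: IHv.
have v0 : 0 < v by rewrite -uv addn_gt0 wt_gt0.
have /andP[/= ji vD] := sD _ su; rewrite uv in vD.
have [M [sigma [phi [z [sigmaD phiD phiz]]]]] := letters_rep yL ji.
have L1 := lead_prodz sigmaD v0 IHv.
have L2 : lead v (fun=> 0%R) (magnus sigmaD (prodz letter_comm s a)).
  by apply: gammaS_lead => //; apply: gamma_sub sa.
have phiMz x k : phi (x *~ k)%R = (phi x *~ k)%R.
  have phiMn x' (n : nat) : phi (x' *+ n)%R = (phi x' *+ n)%R.
    by elim: n => [|n IHn]; rewrite ?addfun0 // !mulrS phiD IHn.
  by case: k => n; rewrite ?NegzE ?mulrNz ?addfunN // phiMn.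
have phi_sum (F : pair -> M) (t : seq pair) (Q : pred pair) :
    phi (\sum_(u <- t | Q u) F u)%R = (\sum_(u <- t | Q u) phi (F u))%R.
  elim: t => [|u t IHt]; first by rewrite !big_nil addfun0.
  by rewrite !big_cons; case: ifP; rewrite ?phiD IHt.
have := congr1 phi (lead_unique L1 L2 z); rewrite [RHS]addfun0 // phi_sum.
rewrite big_mkcond (bigD1_seq (i, j)) //= uv eqxx phiMz phiz // eqxx.
rewrite big_seq_cond big1 ?addr0; first by rewrite intz.
move=> u /andP[su' uij]; case: ifP => // _; rewrite phiMz.
have /andP[u21 _] := sD _ su'.
by rewrite (phiz u.1 u.2) // -surjective_pairing (negPf uij) mul0rz.
Qed.

(** Generation of one lower central factor after the other. *)
Lemma gamma_letters w v : c < w -> w <= v -> v <= c.*2.+2 ->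
  gamma w `<=` gen ([set letter_val i | i in [set i | w <= wt (y i)]] `|` gamma v).
Proof.
move=> cw /subnKC; move: (v - w) => k vE vc; elim: k w cw vE => [|k IHk] w cw vE.
  by move=> x xw; apply: sub_gen; right; rewrite -vE addn0.
apply: subset_trans (letters_gen yL _) _; first by lia.
apply: gen_min; first exact: gen_subgroup.
move=> x [[i /= iw <-]|xw]; first by apply: sub_gen; left; exists i; rewrite //= iw.
apply: (genS _ (IHk w.+1 _ _ _ xw)); try lia.
by move=> z [[i /= iw <-]|zv]; [left; exists i => //=; lia|right].
Qed.

End LetterCommutators.

(** * The section between the two verbal subgroups *)

Section Numerator.
Local Open Scope group_scope.
Local Open Scope classical_set_scope.
Variables (n m c1 c2 : nat).
Hypotheses (n_gt0 : 0 < n) (le_c21 : c2 <= c1) (hc : c1 + n.*2 <= c2.*2.+1).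
Notation P := (fpZ m).
Notation pair r := ('I_r * 'I_r)%type.

Definition numer : set P := comm_sub (gamma c1.+1) (gamma c2.+1).

Definition denom : set P :=
  gen ([set [~ a, b] | a in gamma (c1 + n).+1 & b in gamma c2.+1] `|`
       [set [~ a, b] | a in gamma c1.+1 & b in gamma (c2 + n).+1]).

Lemma denoml a b : gamma (c1 + n).+1 a -> gamma c2.+1 b -> denom [~ a, b].
Proof. by move=> an bn; apply: sub_gen; left; exists a => //; exists b. Qed.

Lemma denomr a b : gamma c1.+1 a -> gamma (c2 + n).+1 b -> denom [~ a, b].
Proof. by move=> an bn; apply: sub_gen; right; exists a => //; exists b. Qed.

Lemma denom_subgroup : is_subgroup denom. Proof. exact: gen_subgroup. Qed.

Lemma denom_normal : is_normal denom.
Proof.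
apply: gen_normal => _ z [] [a an [b bn <-]]; rewrite conjRg; [left|right];
  by exists (a ^ z); [|exists (b ^ z)] => //; apply: gammaJ.
Qed.

Lemma numer_gamma : numer `<=` gamma (c1 + c2).+2.
Proof.
apply: gen_min; first exact: gamma_subgroup.
by move=> _ [a an [b bn <-]]; apply: gammaR_sub an bn => //; lia.
Qed.

Lemma denom_numer : denom `<=` numer.
Proof.
apply: gen_min; first exact: gen_subgroup.
move=> _ [] [a an [b bn <-]]; apply: sub_gen; exists a => //.
- by apply: gamma_sub an; lia.
- by exists b.
- by exists b => //; apply: gamma_sub bn; lia.
Qed.

(** Conjugation by an element of [gamma c2.+1] multiplies the two arguments of
    a commutator by elements that the denominator annihilates. *)
Lemma numer_central x z : numer x -> gamma c2.+1 z -> denom [~ x, z].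
Proof.
move=> xn zn; apply: comm_genN denom_normal _ _ _ xn (sub_gen zn).
move=> _ {zn}z [a an [b bn <-]] zn; pose N := NormalSubgroup denom_normal.
have cN u v : denom [~ u, v] -> commute (coset N u) (coset N v).
  by move=> uv; apply: coset_commute.
apply/(coset_eq1 N); rewrite gmulfR; apply/eqP; rewrite -conjg_fix; apply/eqP.
rewrite -gmulfJ conjRg.
have -> : a ^ z = a * [~ a, z] by rewrite commgEl mulVKg.
have -> : b ^ z = b * [~ b, z] by rewrite commgEl mulVKg.
have a'n : gamma (c1 + n).+1 [~ a, z] by apply: gammaR_sub an zn => //; lia.
have b'n : gamma (c2 + n).+1 [~ b, z] by apply: gammaR_sub bn zn => //; lia.
have b'n2 : gamma c2.+1 [~ b, z] by apply: gamma_sub b'n; lia.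
have abn : gamma c1.+1 [~ a, b] by apply: gammaR_sub an bn => //; lia.
have bb'n : gamma c2.+1 (b * [~ b, z]) by apply: is_subgroupM => //; apply: gamma_subgroup.
have abb'n : gamma c2.+1 [~ a, b * [~ b, z]] by apply: gammaR_sub an bb'n => //; lia.
apply: comm_mod.
- exact: cN (denoml a'n bb'n).
- exact: cN (denoml a'n abb'n).
- exact: commute_sym (cN _ _ (denomr an b'n)).
- exact: commute_sym (cN _ _ (denomr abn b'n)).
Qed.

Section Letters.
Variables (r : nat) (y : 'I_r -> tree 'I_m).
Hypothesis yL : letters c2 y.
Notation letter_val := (letter_val y).
Notation letter_comm := (letter_comm y).
Notation comm_wt := (comm_wt y).

(** For two letters in decreasing order, the first of weight more than [c1], the
    failure of any other condition puts their commutator into the denominator;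
    for the last condition this is seen after exchanging the letters. *)
Definition basic (u : pair r) : bool :=
  [&& u.2 < u.1, c1 < wt (y u.1) <= c1 + n, wt (y u.2) <= c2 + n
    & ~~ ((c2 + n < wt (y u.1)) && (c1 < wt (y u.2)))].

Definition basics : seq (pair r) := [seq u <- enum {: pair r} | basic u].

Lemma letter_val_sub w i : w <= wt (y i) -> gamma w (letter_val i).
Proof. by move=> wi; apply: gamma_sub wi _ (letter_val_gamma _ _). Qed.

Lemma letter_val_wt i : c2 < wt (y i) <= c2.*2.+1. Proof. exact: letters_wt yL i. Qed.

Lemma letter_comm_numer u : basic u -> numer (letter_comm u).
Proof.
case/and4P=> _ /andP[u1 _] _ _; apply: sub_gen.
exists (letter_val u.1); first exact: letter_val_sub.
by exists (letter_val u.2) => //; apply: letter_val_sub; have := letter_val_wt u.2; lia.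
Qed.

(** Modulo the denominator the first argument matters modulo [gamma (c1 + n).+1]
    and the second modulo [gamma (c2 + n).+1], so both can be replaced by letters. *)
Lemma numer_gen : numer `<=` gen ((letter_comm @` [set` basics]) `|` denom).
Proof.
set K := gen _; have sK : is_subgroup K by apply: gen_subgroup.
have denomK : denom `<=` K by move=> x xd; apply: sub_gen; right.
have K_numer : K `<=` numer.
  apply: gen_min; first exact: gen_subgroup.
  move=> _ [[u + <-]|/denom_numer //].
  by rewrite /= mem_filter => /andP[ub _]; apply: letter_comm_numer.
apply: gen_min => // _ [a an [b bn <-]].
have KJ x z : K x -> gamma c2.+1 z -> K (x ^ z).
  move=> Kx zn; have -> : x ^ z = x * [~ x, z] by rewrite commgEl mulVKg.
  by apply: (is_subgroupM sK Kx); apply: (denomK _ (numer_central (K_numer _ Kx) zn)).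
have c1c : c1.+1 <= (c1 + n).+1 by lia.
have c2c : c2.+1 <= (c2 + n).+1 by lia.
apply: (comm_gen sK (gamma_subgroup _ c2.+1) KJ _ _ _
  (gamma_letters yL _ c1c _ an) (gamma_letters yL _ c2c _ bn)); try lia.
- by move=> x [[i /= ic <-]|xn]; [apply: letter_val_sub; lia|apply: gamma_sub xn; lia].
- by move=> x [[i /= ic <-]|xn]; [apply: letter_val_sub; lia|apply: gamma_sub xn; lia].
move=> s t [[i /= ic <-]|sn] tT; last first.
  apply: denomK _ (denoml sn _); case: tT => [[j /= jc <-]|tn]; first by apply: letter_val_sub; lia.
  by apply: gamma_sub tn; lia.
case: tT => [[j /= jc <-]|tn]; last by apply: denomK _ (denomr _ tn); apply: letter_val_sub.
have lcK (u : pair r) : u.2 < u.1 -> c1 < wt (y u.1) -> K (letter_comm u).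
  move=> u21 u1; have u2 := letter_val_wt u.2.
  have [ub|] := boolP (basic u).
    by apply: sub_gen; left; exists u => //=; rewrite mem_filter ub mem_enum.
  rewrite /basic u21 u1 /= 2!negb_and negbK -!ltnNge => /or3P[uc|uc|/andP[uc uc']].
  - by apply: denomK _ (denoml _ _); apply: letter_val_sub; lia.
  - by apply: denomK _ (denomr _ _); apply: letter_val_sub; lia.
  - apply: denomK; rewrite /letter_comm; apply: (is_subgroupRC denom_subgroup).
    by apply: denomr; apply: letter_val_sub; lia.
have [ji|ij|ij] := ltngtP j i.
- exact: (lcK (i, j)).
- apply: (is_subgroupRC sK); apply: (lcK (j, i)) => //=.
  by apply: leq_trans ic _; apply: letters_sorted yL _ _ (ltnW ij).
- by rewrite (val_inj ij : j = i) commgg; apply: subgroup1.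
Qed.

(** The letters of a basic commutator weigh at most [c1 + n] and [c2 + n]. *)
Definition bound := (c1 + c2 + n.*2).

Definition others : seq (pair r) :=
  [seq u : pair r <- enum {: pair r} | [&& u.2 < u.1, ~~ basic u & comm_wt u <= bound]].

(** The arguments are expanded in letters only up to the weight at which their
    commutators exceed [bound]; the hypothesis [hc] ensures that these letters
    weigh at most [c2.*2.+1]. *)
Lemma denom_gen : denom `<=` gen ((letter_comm @` [set` others]) `|` gamma bound.+1).
Proof.
set K := gen _; have sK : is_subgroup K by apply: gen_subgroup.
have hiK : gamma bound.+1 `<=` K by move=> x xd; apply: sub_gen; right.
have K_hi : K `<=` gamma c2.*2.+2.
  apply: gen_min; first exact: gamma_subgroup.
  move=> x [[[i j] _ <-]|]; last by apply: gamma_sub; rewrite /bound; lia.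
  apply: gamma_sub (letter_comm_gamma y (i, j)); rewrite /comm_wt /=.
  by have := letter_val_wt i; have := letter_val_wt j; lia.
have KJ x z : K x -> gamma c2.+1 z -> K (x ^ z).
  move=> /[dup] Kx /K_hi xn zn; have -> : x ^ z = x * [~ x, z] by rewrite commgEl mulVKg.
  apply: (is_subgroupM sK Kx); apply: (hiK).
  by apply: gammaR_sub xn zn => //; rewrite /bound; lia.
have lcK i j : i != j -> c1 < wt (y i) -> c2 < wt (y j) ->
    (c1 + n < wt (y i)) || (c2 + n < wt (y j)) -> K [~ letter_val i, letter_val j].
  move=> ij ic jc ijc.
  have [big|small] := ltnP bound (wt (y i) + wt (y j)).
    by apply: hiK; apply: gamma_sub big _ _; apply: (letter_comm_gamma y (i, j)).
  have [ji|ij'|ijE] := ltngtP j i; last by rewrite (val_inj ijE) eqxx in ij.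
    apply: sub_gen; left; exists (i, j) => //=; rewrite mem_filter mem_enum /=.
    by rewrite ji /comm_wt small /basic ji /= ic inE /=; lia.
  have ji_wt := letters_sorted yL (ltnW ij').
  apply: (is_subgroupRC sK).
  apply: sub_gen; left; exists (j, i) => //=; rewrite mem_filter mem_enum /=.
  by rewrite ij' /comm_wt /= addnC small /basic ij' inE /=; lia.
have main w w' v v' a b : c1 < w -> c2 < w' -> w <= v -> w' <= v' ->
    v <= c2.*2.+2 -> v' <= c2.*2.+2 -> (c1 + n < w) || (c2 + n < w') ->
    bound < w + v' -> bound < v + w' -> gamma w a -> gamma w' b -> K [~ a, b].
  move=> cw cw' wv wv' vc vc' ww' B B' aw bw'.
  have c2w : c2 < w by lia.
  apply: (comm_gen sK (gamma_subgroup _ c2.+1) KJ _ _ _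
    (gamma_letters yL c2w wv vc aw) (gamma_letters yL cw' wv' vc' bw')).
  - by move=> x [[i /= ic <-]|xn]; [apply: letter_val_sub; lia|apply: gamma_sub xn; lia].
  - by move=> x [[i /= ic <-]|xn]; [apply: letter_val_sub; lia|apply: gamma_sub xn; lia].
  move=> s t [[i /= ic <-]|sn] [[j /= jc <-]|tn].
  - have [->|ij] := eqVneq i j; first by rewrite commgg; apply: subgroup1.
    by apply: lcK => //; lia.
  - by apply: hiK; apply: gammaR_sub (letter_val_gamma y i) tn; rewrite ?wt_gt0 //; lia.
  - by apply: hiK; apply: gammaR_sub sn (letter_val_gamma y j); rewrite ?wt_gt0 //; lia.
  - by apply: hiK; apply: gammaR_sub sn tn; lia.
apply: gen_min => // _ [] [a an [b bn <-]].
- by apply: (main (c1 + n).+1 c2.+1 (c1 + n.*2) (c2 + n)) an bn; rewrite /bound; lia.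
- by apply: (main c1.+1 (c2 + n).+1 (c1 + n) (c2 + n.*2)) an bn; rewrite /bound; lia.
Qed.

(** A product of basic commutators that lies in the denominator is, up to weight
    [bound], a product of other commutators of letters. *)
Lemma basics_independent (a : pair r -> int) :
  denom (prodz letter_comm basics a) -> {in basics, a =1 fun=> 0%R}.
Proof.
move=> /denom_gen; set x := prodz _ _ _ => xden.
pose N := NormalSubgroup (gamma_normal P bound.+1).
have eC u v : commute ((coset N \o letter_comm) u) ((coset N \o letter_comm) v).
  apply: coset_commute; apply: gammaR_sub (letter_comm_gamma y u) (letter_comm_gamma y v).
  - by rewrite addn_gt0 wt_gt0.
  - by rewrite addn_gt0 wt_gt0.
  - rewrite /comm_wt /bound;
    have := (letter_val_wt u.1, letter_val_wt u.2, letter_val_wt v.1, letter_val_wt v.2).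
    by move=> [[[]]] /=; lia.
have xgen : gen ((coset N \o letter_comm) @` [set` others]) (coset N x).
  move: x xden; apply: gen_min; first exact/(preim_subgroup (coset N))/gen_subgroup.
  move=> z [[u uo <-]|zN] /=; first by apply: sub_gen; exists u.
  by rewrite (proj2 (coset_eq1 N z) zN); apply: subgroup1 (gen_subgroup _).
have uo : uniq others by rewrite filter_uniq // enum_uniq.
have [b bE] := gen_prodz eC uo xgen.
pose ab u := if basic u then a u else (- b u)%R.
have abE : prodz letter_comm (basics ++ others) ab =
    x * prodz letter_comm others (fun u => - b u)%R.
  rewrite prodz_cat; congr (_ * _); apply: eq_prodz => u.
    by rewrite mem_filter /ab => /andP[->].
  by rewrite mem_filter /ab => /andP[/and3P[_ /negPf ->]].
have relation : gamma bound.+1 (prodz letter_comm (basics ++ others) ab).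
  apply/(coset_eq1 N); rewrite abE cosetM bE (gmulf_prodz (coset N)) (prodzN eC).
  exact: mulgV.
have uu : uniq (basics ++ others).
  rewrite cat_uniq uo filter_uniq ?enum_uniq // andbT /=.
  by apply/hasPn => u; rewrite !mem_filter => /andP[/and3P[_ /negPf -> _] _].
have lo (u : pair r) : u \in basics ++ others -> (u.2 < u.1) && (comm_wt u <= bound).
  rewrite mem_cat !mem_filter => /orP[/andP[/and4P[-> u1 u2 _] _]|].
    by rewrite /comm_wt /bound; lia.
  by move=> /andP[/and3P[-> _ ->]].
move=> u ub; have := letter_comm_independent yL uu lo relation; rewrite /ab => /(_ u).
by rewrite mem_cat ub /= => /(_ isT); move: ub; rewrite mem_filter => /andP[->].
Qed.

End Letters.
End Numerator.

(** * The verbal and marginal subgroups of a commutator word *)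

Section WordEval.
Local Open Scope group_scope.
Local Open Scope classical_set_scope.
Variable F : groupType.
Implicit Types f g : nat -> F.

Lemma word_eval_cat f u v : word_eval f (u ++ v) = word_eval f u * word_eval f v.
Proof. by rewrite /word_eval big_cat. Qed.

Lemma word_eval_inv f u : word_eval f (word_inv u) = (word_eval f u)^-1.
Proof.
rewrite /word_eval /word_inv; elim: u => [|[i b] u IHu]; first by rewrite !big_nil invg1.
rewrite /= rev_cons -cats1 big_cat big_seq1 IHu big_cons invgM /=.
by case: b; rewrite ?invgK.
Qed.

Lemma word_eval_comm f u v : word_eval f (word_comm u v) = [~ word_eval f u, word_eval f v].
Proof. by rewrite /word_comm !word_eval_cat !word_eval_inv. Qed.

Definition left_comm f s c : F := word_eval f (gamma_word s c).

Lemma left_comm1 f s : left_comm f s 1 = f s.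
Proof. by rewrite /left_comm /word_eval big_seq1. Qed.

Lemma left_commS f s c : left_comm f s c.+2 = [~ left_comm f s c.+1, f (s + c.+1)].
Proof.
have E : iota s.+1 c.+1 = iota s.+1 c ++ [:: s + c.+1].
  by rewrite -{1}(addn1 c) iotaD addnS.
rewrite /left_comm /gamma_word [c.+2.-1]/= E foldl_cat word_eval_comm.
by congr [~ _, _]; rewrite /word_eval big_seq1.
Qed.

Lemma eq_left_comm f g s c : (forall j, s <= j <= s + c -> f j = g j) ->
  left_comm f s c.+1 = left_comm g s c.+1.
Proof.
elim: c => [|c IHc] fg; first by rewrite !left_comm1 fg //; lia.
by rewrite !left_commS IHc ?fg // => [|j jc]; [lia|apply: fg; lia].
Qed.

Lemma left_comm_gamma f s c : gamma c.+1 (left_comm f s c.+1).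
Proof. by elim: c => [//|c IHc]; rewrite left_commS; apply: gammaSR. Qed.

Lemma left_comm_1 f s c : f s = 1 -> left_comm f s c.+1 = 1.
Proof.
by move=> fs; elim: c => [|c IHc]; rewrite ?left_comm1 // left_commS IHc comm1g.
Qed.

(** By induction on [c]: the commutator depends only on the entries [s], ...,
    [s + c] of [f], so the next entry can be chosen freely. *)
Lemma gamma_left_comm s k c : gamma (k + c).+1 `<=`
  gen [set left_comm f s c.+1 | f in [set f | gamma k.+1 (f s)]].
Proof.
elim: c => [|c IHc].
  move=> x; rewrite addn0 => xk; apply: sub_gen.
  by exists (fun=> x) => //; rewrite left_comm1.
have nN : is_normal (gen [set left_comm f s c.+2 | f in [set f | gamma k.+1 (f s)]]).
  apply: gen_normal => _ y [f fs <-]; rewrite /left_comm word_evalJ.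
  by exists (fun i => f i ^ y) => //; apply: gammaJ.
rewrite addnS; apply: gen_min; first exact: nN.1.
move=> _ [a /IHc ak [b _ <-]].
apply: (comm_genN nN _ ak (gen_setT b)) => _ t [f fs <-] _; apply: sub_gen.
exists (fun j => if j == s + c.+1 then t else f j) => /=.
  by case: eqP => // ?; exfalso; lia.
rewrite left_commS eqxx; congr [~ _, _]; apply: eq_left_comm => j jc.
by case: eqP => // ?; exfalso; lia.
Qed.

(** A left-normed commutator is multilinear modulo higher weight, wherever the
    factor [r] is inserted. *)
Lemma left_comm_upd n f i r s c : gamma n.+1 r ->
  exists2 z, gamma (c + n).+1 z & left_comm (upd_mulr f i r) s c.+1 = left_comm f s c.+1 * z.
Proof.
move=> rn; have fU j : exists2 z, gamma n.+1 z & upd_mulr f i r j = f j * z.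
  rewrite /upd_mulr; case: eqP => _; first by exists r.
  by exists 1; [apply: subgroup1 (gamma_subgroup _ _)|rewrite mulg1].
elim: c => [|c [z zn uE]]; first by rewrite add0n !left_comm1.
have [b bn bE] := fU (s + c.+1); set u := left_comm f s c.+1 in uE.
have uc : gamma c.+1 u := left_comm_gamma f s c.
exists ([~ u, f (s + c.+1)]^-1 * left_comm (upd_mulr f i r) s c.+2); last first.
  by rewrite [left_comm f s c.+2]left_commS mulVKg.
rewrite left_commS uE bE; set N := NormalSubgroup (gamma_normal F (c.+1 + n).+1).
have cN x y : gamma (c.+1 + n).+1 [~ x, y] -> commute (coset N x) (coset N y).
  by move=> xy; apply: coset_commute.
have zN x : commute (coset N z) (coset N x).
  by apply: cN; apply: gammaSR.
apply/(@cosetP _ N)/esym; apply: comm_mod; [exact: zN|exact: zN| |].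
  by apply: cN; apply: gammaR_sub bn uc; lia.
have ufc : gamma c.+2 [~ u, f (s + c.+1)] by apply: gammaSR.
by apply: cN; apply: gammaR_sub bn ufc; lia.
Qed.

End WordEval.

Section CommutatorWord.
Local Open Scope group_scope.
Local Open Scope classical_set_scope.
Variables (n m c1 c2 : nat).
Hypotheses (n_gt0 : 0 < n) (le_c21 : c2 <= c1) (hc : c1 + n.*2 <= c2.*2.+1).
Notation P := (fpZ m).
Notation V := [set gamma_comm_word c1.+1 c2.+1].

Lemma comm_word_eval (F : groupType) (f : nat -> F) :
  word_eval f (gamma_comm_word c1.+1 c2.+1) = [~ left_comm f 0 c1.+1, left_comm f c1.+1 c2.+1].
Proof. exact: word_eval_comm. Qed.

Lemma comm_word_join (F : groupType) (f f' : nat -> F) :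
  word_eval (fun j => if j <= c1 then f j else f' j) (gamma_comm_word c1.+1 c2.+1) =
  [~ left_comm f 0 c1.+1, left_comm f' c1.+1 c2.+1].
Proof.
rewrite comm_word_eval; congr [~ _, _]; apply: eq_left_comm => j.
  by move=> /andP[_ ->].
by case: leqP => // ?; lia.
Qed.

Lemma verbal_sub : @verbal V P `<=` @numer m c1 c2.
Proof.
apply: gen_min; first exact: gen_subgroup.
move=> _ [_ -> [f ->]]; rewrite comm_word_eval; apply: sub_gen.
by exists (left_comm f 0 c1.+1); [|exists (left_comm f c1.+1 c2.+1)] => //; apply: left_comm_gamma.
Qed.

(** The two halves of the word share no variable, so any two values of them occur
    together. *)
Lemma sub_verbal : @numer m c1 c2 `<=` @verbal V P.
Proof.
have nV : is_normal (@verbal V P).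
  apply: gen_normal => _ y [v Vv [f ->]]; exists v => //.
  by exists (fun i => f i ^ y); rewrite word_evalJ.
apply: gen_min; first exact: nV.1.
move=> _ [a an [b bn <-]].
apply: (comm_genN nV _ (@gamma_left_comm _ 0 0 c1 a an) (@gamma_left_comm _ c1.+1 0 c2 b bn)).
move=> _ _ [f _ <-] [f' _ <-]; apply: sub_gen; exists (gamma_comm_word c1.+1 c2.+1) => //.
by exists (fun j => if j <= c1 then f j else f' j); rewrite comm_word_join.
Qed.

Lemma marginal_sub : marginal_comm V (@gamma P n.+1) `<=` @denom n m c1 c2.
Proof.
apply: gen_min; first exact: denom_subgroup.
move=> _ [_ -> [f [i [r rn ->]]]]; rewrite !comm_word_eval.
have [z zn ->] := left_comm_upd f i 0 c1 rn; have [z' zn' ->] := left_comm_upd f i c1.+1 c2 rn.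
set u := left_comm f 0 c1.+1; set v := left_comm f c1.+1 c2.+1.
have uc : gamma c1.+1 u by apply: left_comm_gamma.
have vc : gamma c2.+1 v by apply: left_comm_gamma.
pose N := NormalSubgroup (denom_normal n m c1 c2).
have cN x y : @denom n m c1 c2 [~ x, y] -> commute (coset N x) (coset N y).
  by move=> xy; apply: coset_commute.
have z'c : gamma c2.+1 z' by apply: gamma_sub zn'; lia.
have vz'c : gamma c2.+1 (v * z') by apply: (is_subgroupM (gamma_subgroup _ _)).
have uvz'c : gamma c2.+1 [~ u, v * z'] by apply: gammaR_sub uc vz'c; lia.
have uvc : gamma c1.+1 [~ u, v] by apply: gammaR_sub uc vc; lia.
apply/(coset_eq1 N); rewrite gmulfF; apply/eqP; rewrite divg_eq1; apply/eqP.
apply: comm_mod.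
- exact: cN (denoml zn vz'c).
- exact: cN (denoml zn uvz'c).
- exact: commute_sym (cN _ _ (denomr uc zn')).
- exact: commute_sym (cN _ _ (denomr uvc zn')).
Qed.

(** A word in commutators becomes trivial when the first entry of either factor
    is 1, so multiplying that entry by [r] yields a value of the word itself. *)
Lemma sub_marginal : @denom n m c1 c2 `<=` marginal_comm V (@gamma P n.+1).
Proof.
have nM := marginal_comm_normal V (gamma_normal P n.+1).
have word_in f i : gamma n.+1 (f i) ->
    word_eval (fun j => if j == i then 1 else f j) (gamma_comm_word c1.+1 c2.+1) = 1 ->
    marginal_comm V (@gamma P n.+1) (word_eval f (gamma_comm_word c1.+1 c2.+1)).
  move=> fi g1; apply: sub_gen; exists (gamma_comm_word c1.+1 c2.+1) => //.
  exists (fun j => if j == i then 1 else f j), i, (f i) => //.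
  rewrite g1 invg1 mulg1; apply: eq_word_eval => j; rewrite /upd_mulr.
  by case: eqP => // ->; rewrite mul1g.
apply: gen_min; first exact: nM.1.
move=> _ [] [a an [b bn <-]].
- rewrite addnC in an.
  apply: (comm_genN nM _ (@gamma_left_comm _ 0 n c1 a an) (@gamma_left_comm _ c1.+1 0 c2 b bn)).
  move=> _ _ [f fn <-] [f' _ <-]; rewrite -comm_word_join; apply: (word_in _ 0) => //.
  by rewrite comm_word_eval left_comm_1 ?comm1g.
- rewrite addnC in bn.
  apply: (comm_genN nM _ (@gamma_left_comm _ 0 0 c1 a an) (@gamma_left_comm _ c1.+1 n c2 b bn)).
  move=> _ _ [f _ <-] [f' fn <-]; rewrite -comm_word_join; apply: (word_in _ c1.+1) => /=.
    by rewrite ltnn.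
  by rewrite comm_word_eval (left_comm_1 (s := c1.+1)) ?eqxx ?commg1.
Qed.

End CommutatorWord.

(** * The free nilpotent group *)

Section NilpotentProduct.
Local Open Scope group_scope.
Local Open Scope classical_set_scope.
Variables (n m : nat).
Hypothesis n_gt0 : 0 < n.
Notation G := (nilpotent_product (fun _ : 'I_m => Algebra.to_multiplicative int) n).

Definition nilp_proj : ghom (fpZ m) G := coset _.

(** The generators of different factors commute modulo the cartesian subgroup. *)
Lemma gamma2_cartesian :
  @gamma (fpZ m) 2 `<=` @cartesian _ (fun _ : 'I_m => Algebra.to_multiplicative int).
Proof.
have nC := ncl_normal (\bigcup_(p in [set p : 'I_m * 'I_m | p.1 != p.2])
  comm_sub (range (@fp_in _ (fun _ : 'I_m => Algebra.to_multiplicative int) p.1))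
    (range (@fp_in _ (fun _ : 'I_m => Algebra.to_multiplicative int) p.2))).
apply: gen_min; first exact: nC.1.
move=> _ [a _ [b _ <-]].
have gT x : gen (range (@fpx m)) x by rewrite fp_gen.
apply: (comm_genN nC _ (gT a) (gT b)) => _ _ [i _ <-] [j _ <-].
have [->|ij] := eqVneq i j; first by rewrite commgg; apply: subgroup1 nC.1.
apply: sub_gen_smallest; exists (i, j) => //; apply: sub_gen.
by exists (fpx i); [exists (1%R : int)|exists (fpx j) => //; exists (1%R : int)].
Qed.

Lemma ker_nilp_proj : ker nilp_proj = @gamma (fpZ m) n.+1.
Proof.
apply/seteqP; split=> x.
  by move=> /coset_eq1[].
move=> xn; apply/coset_eq1; split=> //.
have x2 : @gamma (fpZ m) 2 x by apply: gamma_sub xn.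
exact: (gamma2_cartesian x2).
Qed.

Lemma nilp_proj_onto u : exists x, nilp_proj x = u.
Proof. by exists (repr u); apply: coset_repr. Qed.

Variables (c1 c2 : nat).
Hypotheses (le_c21 : c2 <= c1) (hc : c1 + n.*2 <= c2.*2.+1).
Notation V := [set gamma_comm_word c1.+1 c2.+1].

Lemma baer_nilp_proj r (y : 'I_r -> tree 'I_m) : letters c2 y ->
  isog (baer_invariant V nilp_proj) (Zpow (size (basics n c1 c2 y))).
Proof.
move=> yL.
pose H := Subgroup (is_subgroupI (ker_normal nilp_proj).1
  (gen_subgroup _ : is_subgroup (@verbal V (fpZ m)))).
have Hnumer x : @numer m c1 c2 x -> x \in (H : set (fpZ m)).
  move=> xn; apply/mem_set; split; last exact: sub_verbal.
  rewrite ker_nilp_proj; apply: gamma_sub (numer_gamma n_gt0 le_c21 hc xn); lia.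
have numerH x : x \in (H : set (fpZ m)) -> @numer m c1 c2 x.
  by move=> /set_mem[_ /verbal_sub].
pose N := NormalSubgroup (restr_normal H
  (NormalSubgroup (marginal_comm_normal V (ker_normal nilp_proj)))).
have NE (h : subgroup_type H) : (N : set _) h <-> denom n c1 c2 (subgroup_elt h).
  rewrite /= /restr_set /= ker_nilp_proj.
  by split; [apply: marginal_sub|apply: sub_marginal].
pose eH u : subgroup_type H := insubd 1 (letter_comm y u).
have eHE u : u \in basics n c1 c2 y -> subgroup_elt (eH u) = letter_comm y u.
  rewrite mem_filter => /andP[ub _]; apply: (@insubdK _ _ (subgroup_type H)).
  exact: (Hnumer _ (letter_comm_numer n_gt0 le_c21 hc yL ub)).
have prodE a : subgroup_elt (prodz eH (basics n c1 c2 y) a) =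
    prodz (letter_comm y) (basics n c1 c2 y) a.
  rewrite (gmulf_prodz (@subgroup_elt _ H)); apply: eq_big_seq => u ub.
  by rewrite /= eHE.
apply: (@isog_Zpow (quotient N) _ (basics n c1 c2 y) (coset N \o eH)).
- move=> u v; rewrite -[u]coset_repr -[v]coset_repr; move: (repr u) (repr v) => g h.
  apply/coset_commute/NE; apply: (numer_central n_gt0 le_c21 hc).
    by apply: numerH; apply: subgroup_eltP.
  have := numer_gamma n_gt0 le_c21 hc (numerH _ (subgroup_eltP h)).
  by apply: gamma_sub; lia.
- by rewrite filter_uniq // enum_uniq.
- rewrite -subTset => u _; rewrite -[u]coset_repr; move: (repr u) => h {u}.
  set A := gen _.
  pose K := [set x | exists2 g : subgroup_type H, subgroup_elt g = x & A (coset N g)].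
  have sK : is_subgroup K.
    split=> [|_ _ [g <- gA] [g' <- gA']].
      by exists 1 => //; apply: subgroup1 (gen_subgroup _).
    exists (g / g') => //; rewrite gmulfF; exact: (gen_subgroup _).2.
  have numerK : @numer m c1 c2 `<=` K.
    apply: subset_trans (numer_gen n_gt0 le_c21 hc yL) _; apply: gen_min => // x [[u ub <-]|xd].
      by exists (eH u); [apply: eHE|apply: sub_gen; exists u].
    have xH := Hnumer _ (denom_numer n_gt0 le_c21 hc xd).
    exists (SubgroupElt xH) => //.
    rewrite (proj2 (coset_eq1 N _) (proj2 (NE (SubgroupElt xH)) xd)).
    exact: subgroup1 (gen_subgroup _).
  have [g gh gA] := numerK _ (numerH _ (subgroup_eltP h)).
  by rewrite (_ : h = g) //; apply: val_inj.
- move=> a; rewrite -(gmulf_prodz (coset N)) => /coset_eq1/NE; rewrite prodE.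
  exact: basics_independent.
Qed.

End NilpotentProduct.

(** * The rank *)

Section Triangle.
Local Open Scope nat_scope.
Variable r : nat.

Lemma chi2 (d : rat) : (chi 2 d = (d ^+ 2 - d) / 2%:R)%R.
Proof.
rewrite /chi [divisors 2]/= !big_cons big_nil /moebius /=.
by rewrite addr0 !mul1r ?expr1 mulN1r mulrC.
Qed.

Definition triangle (O : {set 'I_r}) : {set 'I_r * 'I_r} :=
  [set u in finset.setX O O | u.2 < u.1]%SET.

(** The square of [O] consists of the triangle, its mirror image and the diagonal. *)
Lemma card_triangle O : #|triangle O| * 2 + #|O| = #|O| ^ 2.
Proof.
pose swap (u : 'I_r * 'I_r) := (u.2, u.1).
have swapK : involutive swap by case.
pose T' := [set swap u | u in triangle O]%SET.
pose D := [set (i, i) | i in O]%SET.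
have cT : #|T'| = #|triangle O| by apply/card_imset/inv_inj.
have cD : #|D| = #|O| by apply: card_imset => i j [].
have T'E i j : ((i, j) \in T') = [&& i \in O, j \in O & i < j].
  rewrite -[(i, j)]swapK mem_imset; last exact: inv_inj.
  by rewrite !inE /=; case: (i \in O); rewrite ?andbT ?andbF.
have DE i j : ((i, j) \in D) = (i \in O) && (i == j).
  by apply/imsetP/andP => [[k kO [-> ->]]|[iO /eqP <-]]; [rewrite eqxx|exists i].
have -> : #|O| ^ 2 = #|triangle O :|: T' :|: D|.
  rewrite -mulnn -cardsX; apply: eq_card => -[i j].
  rewrite 2!finset.in_setU T'E DE !inE /=.
  have [<-|ij] := eqVneq i j; first by case: (i \in O); rewrite ?ltnn ?orbT.
  by case: (i \in O); case: (j \in O) => //=; case: ltngtP ij => // /val_inj ->; rewrite eqxx.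
have disj (U W : {set 'I_r * 'I_r}) : (forall i j, (i, j) \in U -> (i, j) \notin W) ->
    #|U :|: W| = #|U| + #|W|.
  move=> UW; rewrite -cardsUI (_ : (U :&: W)%SET = finset.set0) ?cards0 ?addn0 //.
  apply/setP => -[k l]; rewrite finset.in_setI finset.in_set0.
  by apply/negP => /andP[/UW /negP].
rewrite !disj ?cT ?cD ?muln2 ?addnn // => i j; rewrite ?finset.in_setU T'E ?DE ?inE /=;
  rewrite -?val_eqE /=; lia.
Qed.

End Triangle.

Section Rank.
Local Open Scope nat_scope.
Variables (n m c1 c2 r : nat) (y : 'I_r -> tree 'I_m).
Hypothesis yL : letters c2 y.

Definition window p q : {set 'I_r} := [set i | p < wt (y i) <= q]%SET.

Lemma chi_window p q : c2 <= p -> p <= q -> q <= c2.*2.+1 ->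
  (\sum_(p + 1 <= w < q.+1) chi w m%:R = #|window p q|%:R :> rat)%R.
Proof.
move=> c2p /subnKC <-; elim: (q - p) => [_|k IHk kc].
  rewrite addn0 addn1 big_geq // (_ : window p p = finset.set0) ?cards0 //.
  by apply/setP => i; rewrite !inE; lia.
rewrite addnS in kc *; have -> : window p (p + k).+1 =
    (window p (p + k) :|: [set i | wt (y i) == (p + k).+1])%SET.
  by apply/setP => i; rewrite !inE; lia.
rewrite big_nat_recr; last by lia.
rewrite /= IHk; last by lia.
rewrite (letters_chi yL); last by lia.
rewrite -natrD -cardsUI (_ : (_ :&: _)%SET = finset.set0) ?cards0 ?addn0 //.
by apply/setP => i; rewrite !inE; lia.
Qed.

(** When the second letter weighs at most [c1] the order of the letters follows
    from their weights; otherwise both weights lie in the same window. *)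
Lemma card_basic : c2 <= c1 -> #|[set u | basic n c1 c2 y u]%SET| =
  #|window c1 (c1 + n)| * #|window c2 (minn c1 (c2 + n))| + #|triangle (window c1 (c2 + n))|.
Proof.
move=> le_c21; set A := window _ _; set B := window _ _; set T := triangle _.
have -> : [set u | basic n c1 c2 y u]%SET = (finset.setX A B :|: T)%SET.
  apply/setP => -[i j]; rewrite !inE /basic /= .
  have := letters_wt yL i; have := letters_wt yL j.
  have [ij|ji] := leqP i j.
    by have := letters_sorted yL ij; lia.
  by have := letters_sorted yL (ltnW ji); lia.
have := cardsUI (finset.setX A B) T; rewrite cardsX.
have -> : (finset.setX A B :&: T)%SET = finset.set0.
  by apply/setP => -[i j]; rewrite !inE /=; lia.
by rewrite cards0 addn0.
Qed.

End Rank.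

Theorem corollary2p9 (n m c1 c2 : nat)
    (n_gt0 : (0 < n)%N) (m_gt0 : (0 < m)%N)
    (c1_gt0 : (0 < c1)%N) (c2_gt0 : (0 < c2)%N)
    (le_c21 : (c2 <= c1)%N)
    (hc : (2 * n%:Z - 2 < 2 * c2%:Z - c1%:Z)%R)
    (F : groupType)
    (pi : ghom F (nilpotent_product (fun _ : 'I_m => Algebra.to_multiplicative int) n))
    (pi_free : free_presentation pi) :
  let VM := baer_invariant [set gamma_comm_word c1.+1 c2.+1]%classic pi in
  ((c2 + n < c1 + 1)%N ->
     exists k : nat,
       (k%:R = (\sum_(c1 + 1 <= i < (c1 + n).+1) chi i m%:R)
               * (\sum_(c2 + 1 <= i < (c2 + n).+1) chi i m%:R))%R
       /\ isog VM (Zpow k)) /\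
  ((c1 + 1 <= c2 + n)%N ->
     exists k' : nat,
       (k'%:R = (\sum_(c1 + 1 <= i < (c1 + n).+1) chi i m%:R)
                * (\sum_(c2 + 1 <= i < c1.+1) chi i m%:R)
                + chi 2 (\sum_(c1 + 1 <= i < (c2 + n).+1) chi i m%:R))%R
       /\ isog VM (Zpow k')).
Proof.
move=> VM; have {}hc : c1 + n.*2 <= c2.*2.+1 by lia.
have [r [y yL]] := letters_exist m c2.
have VMk : isog VM (Zpow (size (basics n c1 c2 y))).
  apply: isog_trans (baer_nilp_proj n_gt0 le_c21 hc yL).
  have [[X [b bF]] pi_onto] := pi_free.
  have [f [fb _]] := bF _ (fun x => projT1 (cid (nilp_proj_onto (pi (b x))))).
  pose f' : ghom (fpZ m) F := fp_lift (fun i => projT1 (cid (pi_onto (nilp_proj n m (fpx i))))).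
  apply: (@baer_isog _ _ _ _ pi (nilp_proj n m) f f').
    have [g [_ g_uniq]] := bF _ (pi \o b).
    move=> x; rewrite -[LHS]/((nilp_proj n m \o f) x) (g_uniq (nilp_proj n m \o f)).
      by rewrite (g_uniq pi).
    by move=> z /=; rewrite fb; apply: (projT2 (cid (nilp_proj_onto (pi (b z))))).
  apply: (@fp_hom_eq m _ (pi \o f')) => i /=.
  by rewrite fp_liftx; apply: (projT2 (cid (pi_onto (nilp_proj n m (fpx i))))).
have k_card : size (basics n c1 c2 y) = #|[set u | basic n c1 c2 y u]%SET|.
  rewrite cardsE cardE; congr size.
  by rewrite /basics {2}/enum_mem -enumT.
split=> c12; exists (size (basics n c1 c2 y)); split=> //; rewrite k_card (card_basic _ yL) //.
- rewrite !(chi_window yL) ?(minn_idPr _); try lia.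
  have -> : triangle (window y c1 (c2 + n)) = finset.set0.
    by apply/setP => -[i j]; rewrite !inE; lia.
  by rewrite cards0 addn0 natrM.
- rewrite !(chi_window yL) ?(minn_idPl _); try lia.
  rewrite chi2 natrD natrM -natrX -card_triangle natrD natrM addrK mulfK //.
Qed.
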